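(* Let $k$ be a field of characteristic zero, let $(\mathcal{A},[\cdot,\cdot],\triangleright)$ be a post-Lie algebra over $k$, let $\mathfrak{g}=(\mathcal{A},[\cdot,\cdot])$, and let $\bar{\mathfrak{g}}=(\mathcal{A},\llbracket\cdot,\cdot\rrbracket)$ be the Lie algebra on the same vector space with bracket $\llbracket x,y\rrbracket=x\triangleright y-y\triangleright x+[x,y]$. Then the Hopf algebra $(\mathcal{U}(\mathfrak{g}),*,\Delta)$, with $A*B=A_{(1)}(A_{(2)}\triangleright B)$, is isomorphic as a Hopf algebra to the universal enveloping algebra $\mathcal{U}(\bar{\mathfrak{g}})$.
   Context: A post-Lie algebra $(\mathcal{A},[\cdot,\cdot],\triangleright)$ is a Lie algebra $\mathfrak{g}=(\mathcal{A},[\cdot,\cdot])$ together with a bilinear product $\triangleright:\mathcal{A}\times\mathcal{A}\to\mathcal{A}$ such that for all $x,y,z$: $x\triangleright[y,z]=[x\triangleright y,z]+[y,x\triangleright z]$ and $[x,y]\triangleright z=a_\triangleright(x,y,z)-a_\triangleright(y,x,z)$, where $a_\triangleright(x,y,z)=x\triangleright(y\triangleright z)-(x\triangleright y)\triangleright z$. The bracket $\llbracket\cdot,\cdot\rrbracket$ is then a Lie bracket on $\mathcal{A}$. $\mathcal{U}(\mathfrak{g})$ is the universal enveloping algebra with unit $\mathbf{1}$ and product written as concatenation. $\Delta$ is the coshuffle coproduct: the algebra morphism (for concatenation) with $\Delta(x)=x\otimes\mathbf{1}+\mathbf{1}\otimes x$ for $x\in\mathfrak{g}$. Sweedler notation $\Delta(A)=A_{(1)}\otimes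 A_{(2)}$ is used. $\mathcal{U}(\bar{\mathfrak{g}})$ carries its usual Hopf algebra structure (elements of $\bar{\mathfrak{g}}$ primitive). The product $\triangleright$ extends uniquely from $\mathfrak{g}$ to a bilinear product on $\mathcal{U}(\mathfrak{g})$ satisfying, for $A,B,C\in\mathcal{U}(\mathfrak{g})$, $x,y\in\mathfrak{g}$: $\mathbf{1}\triangleright A=A$; $(xA)\triangleright y=x\triangleright(A\triangleright y)-(x\triangleright A)\triangleright y$; $A\triangleright(BC)=(A_{(1)}\triangleright B)(A_{(2)}\triangleright C)$. With these data $(\mathcal{U}(\mathfrak{g}),*,\Delta)$ is a Hopf algebra. *)

(* Defs.v *)
From HB Require Import structures.
From mathcomp Require Import all_boot all_algebra.
From mathcomp Require Import boolp.

Set Implicit Arguments.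
Unset Strict Implicit.
Unset Printing Implicit Defensive.

Import GRing.Theory.
Local Open Scope ring_scope.
Local Open Scope quotient_scope.

Definition bilinear_map (k : fieldType) (U V W : lmodType k)
    (f : U -> V -> W) : Prop :=
  (forall v, linear (f^~ v)) /\ (forall u, linear (f u)).

Section BilinearTheory.
Variables (k : fieldType) (U V W : lmodType k) (f : U -> V -> W).
Hypothesis f_bil : bilinear_map f.

Lemma bilDl v u u' : f (u + u') v = f u v + f u' v.
Proof. by have := f_bil.1 v 1 u u'; rewrite !scale1r. Qed.

Lemma bilDr u v v' : f u (v + v') = f u v + f u v'.
Proof. by have := f_bil.2 u 1 v v'; rewrite !scale1r. Qed.

Lemma bilZl a u v : f (a *: u) v = a *: f u v.
Proof. exact: (scalable_linear (f_bil.1 v) a u). Qed.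

Lemma bilZr a u v : f u (a *: v) = a *: f u v.
Proof. exact: (scalable_linear (f_bil.2 u) a v). Qed.

Lemma bilNl u v : f (- u) v = - f u v.
Proof. by rewrite -scaleN1r bilZl scaleN1r. Qed.

Lemma bilNr u v : f u (- v) = - f u v.
Proof. by rewrite -scaleN1r bilZr scaleN1r. Qed.

End BilinearTheory.

(* The tensor product over k: formal finite sums of pairs (v, w), standing for
   \sum v (x) w, modulo the congruence generated by the usual relations. *)
Section TensorProduct.
Variables (k : fieldType) (V W : lmodType k).

Inductive tens_eq : seq (V * W) -> seq (V * W) -> Prop :=
| teq_refl s : tens_eq s s
| teq_sym s t : tens_eq s t -> tens_eq t s
| teq_trans s t u : tens_eq s t -> tens_eq t u -> tens_eq s u
| teq_cat s s' t t' : tens_eq s s' -> tens_eq t t' ->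
    tens_eq (s ++ t) (s' ++ t')
| teq_catC s t : tens_eq (s ++ t) (t ++ s)
| teq_addl v v' w : tens_eq [:: (v + v', w)] [:: (v, w); (v', w)]
| teq_addr v w w' : tens_eq [:: (v, w + w')] [:: (v, w); (v, w')]
| teq_scale a v w : tens_eq [:: (a *: v, w)] [:: (v, a *: w)]
| teq_0 w : tens_eq [:: (0, w)] [::].

Definition tens_rel (s t : seq (V * W)) : bool := `[< tens_eq s t >].

Fact tens_rel_refl : reflexive tens_rel.
Proof. by move=> s; apply/asboolP; exact: teq_refl. Qed.

Fact tens_rel_sym : symmetric tens_rel.
Proof. by move=> s t; apply/asboolP/asboolP; exact: teq_sym. Qed.

Fact tens_rel_trans : transitive tens_rel.
Proof.
move=> t s u /asboolP st /asboolP tu; apply/asboolP; exact: teq_trans st tu.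
Qed.

Canonical tens_equiv := EquivRel tens_rel tens_rel_refl tens_rel_sym
  tens_rel_trans.

Definition tens := {eq_quot tens_rel}.

HB.instance Definition _ : EqQuotient _ tens_rel tens := EqQuotient.on tens.
HB.instance Definition _ := Choice.on tens.

Lemma tens_piP (s t : seq (V * W)) : \pi_tens s = \pi_tens t <-> tens_eq s t.
Proof. by split=> [/eqmodP/asboolP|st] //; apply/eqmodP/asboolP. Qed.

Lemma tens_reprP (s : seq (V * W)) : tens_eq (repr (\pi_tens s)) s.
Proof. by apply/tens_piP; rewrite reprK. Qed.

Definition tens_add (x y : tens) : tens := \pi_tens (repr x ++ repr y).
Definition tens_zero : tens := \pi_tens [::].
Definition tscale_seq (a : k) (s : seq (V * W)) :=
  [seq (a *: p.1, p.2) | p <- s].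
Definition tens_scale (a : k) (x : tens) : tens := \pi_tens (tscale_seq a (repr x)).
Definition tens_opp := tens_scale (-1).

Lemma tens_addE s t : tens_add (\pi_tens s) (\pi_tens t) = \pi_tens (s ++ t).
Proof. by apply/tens_piP; apply: teq_cat; apply: tens_reprP. Qed.

Lemma tscale_seq_eq a s t : tens_eq s t ->
  tens_eq (tscale_seq a s) (tscale_seq a t).
Proof.
elim=> [{}s|{}s {}t _ /teq_sym //|{}s {}t u _ + _|s1 s2 t1 t2 _ + _|{}s {}t|v v' w
  |v w w'|b v w|w]; rewrite /tscale_seq ?map_cat /=.
- exact: teq_refl.
- exact: teq_trans.
- exact: teq_cat.
- exact: teq_catC.
- by rewrite scalerDr; apply: teq_addl.
- exact: teq_addr.
- by rewrite scalerA mulrC -scalerA; apply: teq_scale.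
- by rewrite scaler0; apply: teq_0.
Qed.

Lemma tens_scaleE a s : tens_scale a (\pi_tens s) = \pi_tens (tscale_seq a s).
Proof. by apply/tens_piP; apply/tscale_seq_eq/tens_reprP. Qed.

Lemma tens_quot (x : tens) : exists s, x = \pi_tens s.
Proof. by exists (repr x); rewrite reprK. Qed.

Fact tens_addA : associative tens_add.
Proof.
move=> x y z; have [s ->] := tens_quot x; have [t ->] := tens_quot y.
by have [u ->] := tens_quot z; rewrite !tens_addE catA.
Qed.

Fact tens_addC : commutative tens_add.
Proof.
move=> x y; have [s ->] := tens_quot x; have [t ->] := tens_quot y.
by rewrite !tens_addE; apply/tens_piP/teq_catC.
Qed.

Fact tens_add0 : left_id tens_zero tens_add.
Proof. by move=> x; have [s ->] := tens_quot x; rewrite tens_addE. Qed.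

Lemma tens_scale0 x : tens_scale 0 x = tens_zero.
Proof.
have [s ->] := tens_quot x; rewrite tens_scaleE; apply/tens_piP.
elim: s => [|p s IHs]; first exact: teq_refl.
rewrite /= scale0r -cat1s -[[::]]/([::] ++ [::]).
by apply: teq_cat => //; apply: teq_0.
Qed.

Lemma tens_scaleDl x a b :
  tens_scale (a + b) x = tens_add (tens_scale a x) (tens_scale b x).
Proof.
have [s ->] := tens_quot x; rewrite !tens_scaleE tens_addE; apply/tens_piP.
elim: s => [|p s IHs] /=; first exact: teq_refl.
rewrite scalerDl -cat1s.
apply: (teq_trans (teq_cat (teq_addl _ _ _) IHs)) => /=.
rewrite -cat1s -[X in tens_eq _ X]cat1s; apply: teq_cat; first exact: teq_refl.
rewrite -cat1s -[X in tens_eq _ (_ ++ X)]cat1s !catA.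
by apply: teq_cat (teq_refl _); apply: teq_catC.
Qed.

Lemma tens_scale1 : left_id 1 tens_scale.
Proof.
move=> x; have [s ->] := tens_quot x; rewrite tens_scaleE; congr (\pi _).
by elim: s => //= -[v w] s ->; rewrite scale1r.
Qed.

Fact tens_addN : left_inverse tens_zero tens_opp tens_add.
Proof.
move=> x; rewrite -[X in tens_add _ X]tens_scale1 -tens_scaleDl addNr.
exact: tens_scale0.
Qed.

HB.instance Definition _ :=
  GRing.isZmodule.Build tens tens_addA tens_addC tens_add0 tens_addN.

Fact tens_scaleA a b x : tens_scale a (tens_scale b x) = tens_scale (a * b) x.
Proof.
have [s ->] := tens_quot x; rewrite !tens_scaleE; congr (\pi _).
by elim: s => //= p s ->; rewrite scalerA.
Qed.

Fact tens_scaleDr : right_distributive tens_scale +%R.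
Proof.
move=> a x y; have [s ->] := tens_quot x; have [t ->] := tens_quot y.
by rewrite /GRing.add /= tens_addE !tens_scaleE tens_addE /tscale_seq map_cat.
Qed.

HB.instance Definition _ := GRing.Zmodule_isLmodule.Build k tens
  tens_scaleA tens_scale1 tens_scaleDr tens_scaleDl.

Definition tensor (v : V) (w : W) : tens := \pi_tens [:: (v, w)].

Lemma tensor_bilinear : bilinear_map tensor.
Proof.
split=> [w a v v'|v a w w']; rewrite /tensor /GRing.scale /= tens_scaleE.
  rewrite /GRing.add /= tens_addE; apply/tens_piP; exact: teq_addl.
rewrite /GRing.add /= tens_addE; apply/tens_piP.
apply: (teq_trans (teq_addr _ _ _)).
apply: (@teq_cat [:: _] [:: _] [:: _] [:: _]); last exact: teq_refl.
exact/teq_sym/teq_scale.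
Qed.

Lemma tens_sumE (t : tens) : t = \sum_(p <- repr t) tensor p.1 p.2.
Proof.
rewrite -[LHS]reprK; elim: (repr t) => [|[v w] s IHs]; first by rewrite big_nil.
by rewrite big_cons -IHs /tensor -[LHS](tens_addE [:: (v, w)] s).
Qed.

(* Sweedler notation: tlift f (Delta a) is the sum of f a_(1) a_(2) over some
   representation of Delta a as a sum of pure tensors. When f is bilinear the
   choice of the representation is immaterial, and tlift f is the linear map
   through which f factors (tlift_tensor, tlift_linear). *)
Definition tlift (M : lmodType k) (f : V -> W -> M) (t : tens) : M :=
  \sum_(p <- repr t) f p.1 p.2.

Section Lift.
Variables (M : lmodType k) (f : V -> W -> M).
Hypothesis f_bil : bilinear_map f.

Lemma tlift_eq (s t : seq (V * W)) : tens_eq s t ->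
  \sum_(p <- s) f p.1 p.2 = \sum_(p <- t) f p.1 p.2.
Proof.
elim=> //=.
- by move=> {}s {}t u _ -> _ ->.
- by move=> s1 s2 t1 t2 _ e1 _ e2; rewrite !big_cat e1 e2.
- by move=> {}s {}t; rewrite !big_cat /= addrC.
- by move=> v v' w; rewrite !big_cons !big_nil !addr0 (bilDl f_bil).
- by move=> v w w'; rewrite !big_cons !big_nil !addr0 (bilDr f_bil).
- by move=> a v w; rewrite !big_cons !big_nil (bilZl f_bil) (bilZr f_bil).
- by move=> w; rewrite big_cons !big_nil -(scale0r 0) (bilZl f_bil) !scale0r addr0.
Qed.

Lemma tlift_pi (s : seq (V * W)) : tlift f (\pi_tens s) = \sum_(p <- s) f p.1 p.2.
Proof.
exact/tlift_eq/tens_reprP.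
Qed.

Lemma tlift_tensor v w : tlift f (tensor v w) = f v w.
Proof. by rewrite /tensor tlift_pi big_cons big_nil addr0. Qed.

Lemma tlift_linear : linear (tlift f).
Proof.
move=> a x y; have [s ->] := tens_quot x; have [t ->] := tens_quot y.
rewrite [a *: _]tens_scaleE [_ + _]tens_addE !tlift_pi.
rewrite big_cat /tscale_seq big_map scaler_sumr; congr (_ + _).
apply: eq_bigr => p _; exact: bilZl.
Qed.

End Lift.

Lemma linear_tens_ext (M : lmodType k) (f g : tens -> M) :
  linear f -> linear g -> (forall v w, f (tensor v w) = g (tensor v w)) ->
  f =1 g.
Proof.
move=> lf lg fg t; rewrite [t]tens_sumE.
pose F : {linear tens -> M} := HB.pack f (GRing.isLinear.Build _ _ _ _ f lf).
pose G : {linear tens -> M} := HB.pack g (GRing.isLinear.Build _ _ _ _ g lg).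
rewrite -[f]/(F : _ -> _) -[g]/(G : _ -> _) !linear_sum.
by apply: eq_bigr => p _; apply: fg.
Qed.

End TensorProduct.

Definition tmap (k : fieldType) (V W V' W' : lmodType k)
    (f : V -> V') (g : W -> W') : tens V W -> tens V' W' :=
  tlift (fun v w => tensor (f v) (g w)).

Definition tassoc (k : fieldType) (U V W : lmodType k) :
    tens (tens U V) W -> tens U (tens V W) :=
  tlift (fun uv w => tlift (fun u v => tensor u (tensor v w)) uv).

Record is_algebra (k : fieldType) (A : lmodType k)
    (mul : A -> A -> A) (one : A) : Prop := IsAlgebra {
  alg_bilinear : bilinear_map mul;
  alg_mulA : associative mul;
  alg_mul1l : left_id one mul;
  alg_mul1r : right_id one mul
}.

Definition tens_mul (k : fieldType) (A B : lmodType k)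
    (mulA : A -> A -> A) (mulB : B -> B -> B) (s t : tens A B) : tens A B :=
  tlift (fun a b => tlift (fun a' b' => tensor (mulA a a') (mulB b b')) t) s.

Record is_hopf_algebra (k : fieldType) (H : lmodType k)
    (mul : H -> H -> H) (one : H) (Delta : H -> tens H H)
    (eps : H -> k) (S : H -> H) : Prop := IsHopfAlgebra {
  hopf_algebraP : is_algebra mul one;
  hopf_comul_linear : linear Delta;
  hopf_counit_linear : scalar eps;
  hopf_antipode_linear : linear S;
  hopf_coassoc : forall a,
    tassoc (tmap Delta id (Delta a)) = tmap id Delta (Delta a);
  hopf_counitl : forall a, tlift (fun a1 a2 => eps a1 *: a2) (Delta a) = a;
  hopf_counitr : forall a, tlift (fun a1 a2 => eps a2 *: a1) (Delta a) = a;
  hopf_comul1 : Delta one = tensor one one;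
  hopf_comulM : forall a b,
    Delta (mul a b) = tens_mul mul mul (Delta a) (Delta b);
  hopf_counit1 : eps one = 1;
  hopf_counitM : forall a b, eps (mul a b) = eps a * eps b;
  hopf_antipodel : forall a,
    tlift (fun a1 a2 => mul (S a1) a2) (Delta a) = eps a *: one;
  hopf_antipoder : forall a,
    tlift (fun a1 a2 => mul a1 (S a2)) (Delta a) = eps a *: one
}.

Record hopf_algebra (k : fieldType) := HopfAlgebra {
  hopf_sort :> lmodType k;
  hopf_mul : hopf_sort -> hopf_sort -> hopf_sort;
  hopf_one : hopf_sort;
  hopf_comul : hopf_sort -> tens hopf_sort hopf_sort;
  hopf_counit : hopf_sort -> k;
  hopf_antipode : hopf_sort -> hopf_sort;
  hopfP : is_hopf_algebra hopf_mul hopf_one hopf_comul hopf_counit hopf_antipode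
}.

Record is_hopf_morphism (k : fieldType) (H K : hopf_algebra k)
    (f : H -> K) : Prop := IsHopfMorphism {
  hmor_linear : linear f;
  hmor_mul : forall a b, f (hopf_mul a b) = hopf_mul (f a) (f b);
  hmor_one : f (hopf_one H) = hopf_one K;
  hmor_comul : forall a, hopf_comul (f a) = tmap f f (hopf_comul a);
  hmor_counit : forall a, hopf_counit (f a) = hopf_counit a;
  hmor_antipode : forall a, f (hopf_antipode a) = hopf_antipode (f a)
}.

Definition hopf_isomorphic (k : fieldType) (H K : hopf_algebra k) : Prop :=
  exists2 f : H -> K, is_hopf_morphism f & bijective f.

Record is_lie_bracket (k : fieldType) (V : lmodType k)
    (br : V -> V -> V) : Prop := IsLieBracket {
  lie_bilinear : bilinear_map br;
  lie_alternating : forall x, br x x = 0;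
  lie_jacobi : forall x y z,
    br x (br y z) + br y (br z x) + br z (br x y) = 0
}.

Record lie_algebra (k : fieldType) := LieAlgebra {
  lie_sort :> lmodType k;
  lie_br : lie_sort -> lie_sort -> lie_sort;
  lieP : is_lie_bracket lie_br
}.

Definition associator (V : zmodType) (tri : V -> V -> V) (x y z : V) : V :=
  tri x (tri y z) - tri (tri x y) z.

Record post_lie_algebra (k : fieldType) := PostLieAlgebra {
  pl_lie :> lie_algebra k;
  pl_tri : pl_lie -> pl_lie -> pl_lie;
  pl_tri_bilinear : bilinear_map pl_tri;
  pl_tri_br : forall x y z : pl_lie,
    pl_tri x (lie_br y z) = lie_br (pl_tri x y) z + lie_br y (pl_tri x z);
  pl_br_tri : forall x y z : pl_lie,
    pl_tri (lie_br x y) z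
    = associator pl_tri x y z - associator pl_tri y x z
}.

(* Decides E = 0 in an abelian group when E is a sum of atoms and of opposites
   of atoms that cancel out in pairs. *)
Ltac bring_front t :=
  lazymatch goal with
  | |- (t + _)%R = _ => idtac
  | _ => rewrite (addrCA _ t); bring_front t
  end.
Ltac zmod_cancel :=
  rewrite -[LHS]addr0 ?(opprD, opprK) -?addrA;
  repeat lazymatch goal with
  | |- (- ?b + _)%R = _ => bring_front b; rewrite addrA subrr add0r
  | |- (?b + _)%R = _ => bring_front (- b)%R; rewrite addrA addNr add0r
  end.

Section SubAdjacent.
Variables (k : fieldType) (P : post_lie_algebra k).

Definition sub_adjacent_br (x y : P) : P :=
  pl_tri x y - pl_tri y x + lie_br x y.

Lemma lie_brC (x y : P) : lie_br x y = - lie_br y x.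
Proof.
have b := lie_bilinear (lieP P).
have := lie_alternating (lieP P) (x + y).
rewrite (bilDl b) !(bilDr b) !(lie_alternating (lieP P)) add0r addr0.
by move/addr0_eq => <-; rewrite opprK.
Qed.



Lemma lie_jacobi_der (x y z : P) :
  lie_br x (lie_br y z) = lie_br (lie_br x y) z + lie_br y (lie_br x z).
Proof.
have b := lie_bilinear (lieP P).
have := lie_jacobi (lieP P) x y z.
rewrite (lie_brC z (lie_br x y)) (lie_brC z x) (bilNr b) -addrA -opprD.
by move/eqP; rewrite subr_eq0 addrC => /eqP.
Qed.

Lemma sub_adjacent_jacobi (x y z : P) :
  sub_adjacent_br x (sub_adjacent_br y z)
  + sub_adjacent_br y (sub_adjacent_br z x)
  + sub_adjacent_br z (sub_adjacent_br x y) = 0.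
Proof.
have b := lie_bilinear (lieP P); have t := pl_tri_bilinear P.
rewrite /sub_adjacent_br.
rewrite !(bilDl b, bilDr b, bilDl t, bilDr t).
rewrite !(bilNl b, bilNr b, bilNl t, bilNr t).
rewrite !pl_tri_br !pl_br_tri /associator.
rewrite (lie_jacobi_der x y z) !(lie_brC (pl_tri _ _)).
rewrite (lie_brC (lie_br x y)) (lie_brC z x) (bilNr b).
by zmod_cancel.
Qed.

Lemma sub_adjacent_is_lie : is_lie_bracket sub_adjacent_br.
Proof.
have b := lie_bilinear (lieP P); have t := pl_tri_bilinear P.
split; last exact: sub_adjacent_jacobi.
- split=> [y a x x'|x a y y'] /=; apply/eqP; rewrite -subr_eq0; apply/eqP;
    rewrite /sub_adjacent_br !(bilDl b, bilDr b, bilDl t, bilDr t)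
      !(bilZl b, bilZr b, bilZl t, bilZr t) !scalerDr !scalerN;
    by zmod_cancel.
- by move=> x; rewrite /sub_adjacent_br subrr add0r (lie_alternating (lieP P)).
Qed.

Definition sub_adjacent : lie_algebra k := LieAlgebra sub_adjacent_is_lie.

End SubAdjacent.

(* The universal enveloping algebra, presented as the associative unital
   k-algebra on generators x in g, subject to linearity in x and to the
   relations x y = y x + [x, y]. *)
Inductive uea_expr (k V : Type) : Type :=
| UGen of V
| UOne
| UZero
| UAdd of uea_expr k V & uea_expr k V
| UMul of uea_expr k V & uea_expr k V
| UScale of k & uea_expr k V.

Arguments UGen {k V}.
Arguments UOne {k V}.
Arguments UZero {k V}.

HB.instance Definition _ (k V : Type) := gen_eqMixin (uea_expr k V).
HB.instance Definition _ (k V : Type) := gen_choiceMixin (uea_expr k V).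

Section UniversalEnvelopingAlgebra.
Variables (k : fieldType) (g : lie_algebra k).
Local Notation expr := (uea_expr k g).

Inductive uea_eq : expr -> expr -> Prop :=
| ueq_refl a : uea_eq a a
| ueq_sym a b : uea_eq a b -> uea_eq b a
| ueq_trans a b c : uea_eq a b -> uea_eq b c -> uea_eq a c
| ueq_add a a' b b' : uea_eq a a' -> uea_eq b b' ->
    uea_eq (UAdd a b) (UAdd a' b')
| ueq_mul a a' b b' : uea_eq a a' -> uea_eq b b' ->
    uea_eq (UMul a b) (UMul a' b')
| ueq_scale c a a' : uea_eq a a' -> uea_eq (UScale c a) (UScale c a')
| ueq_addA a b c : uea_eq (UAdd a (UAdd b c)) (UAdd (UAdd a b) c)
| ueq_addC a b : uea_eq (UAdd a b) (UAdd b a)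
| ueq_add0 a : uea_eq (UAdd UZero a) a
| ueq_scaleA c d a : uea_eq (UScale c (UScale d a)) (UScale (c * d) a)
| ueq_scale1 a : uea_eq (UScale 1 a) a
| ueq_scale0 a : uea_eq (UScale 0 a) UZero
| ueq_scaleDl c d a : uea_eq (UScale (c + d) a) (UAdd (UScale c a) (UScale d a))
| ueq_scaleDr c a b : uea_eq (UScale c (UAdd a b)) (UAdd (UScale c a) (UScale c b))
| ueq_mulA a b c : uea_eq (UMul a (UMul b c)) (UMul (UMul a b) c)
| ueq_mul1l a : uea_eq (UMul UOne a) a
| ueq_mul1r a : uea_eq (UMul a UOne) a
| ueq_mulDl a b c : uea_eq (UMul (UAdd a b) c) (UAdd (UMul a c) (UMul b c))
| ueq_mulDr a b c : uea_eq (UMul a (UAdd b c)) (UAdd (UMul a b) (UMul a c))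
| ueq_scaleAl c a b : uea_eq (UScale c (UMul a b)) (UMul (UScale c a) b)
| ueq_scaleAr c a b : uea_eq (UScale c (UMul a b)) (UMul a (UScale c b))
| ueq_gen c x y : uea_eq (UGen (c *: x + y)) (UAdd (UScale c (UGen x)) (UGen y))
| ueq_br x y : uea_eq (UMul (UGen x) (UGen y))
                      (UAdd (UMul (UGen y) (UGen x)) (UGen (lie_br x y))).

Definition uea_rel (a b : expr) : bool := `[< uea_eq a b >].

Fact uea_rel_refl : reflexive uea_rel.
Proof. by move=> s; apply/asboolP; exact: ueq_refl. Qed.

Fact uea_rel_sym : symmetric uea_rel.
Proof. by move=> s t; apply/asboolP/asboolP; exact: ueq_sym. Qed.

Fact uea_rel_trans : transitive uea_rel.
Proof.
move=> t s u /asboolP st /asboolP tu; apply/asboolP; exact: ueq_trans st tu.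
Qed.

Canonical uea_equiv := EquivRel uea_rel uea_rel_refl uea_rel_sym uea_rel_trans.

Definition uea := {eq_quot uea_rel}.

HB.instance Definition _ : EqQuotient _ uea_rel uea := EqQuotient.on uea.
HB.instance Definition _ := Choice.on uea.

Lemma uea_piP (a b : expr) : \pi_uea a = \pi_uea b <-> uea_eq a b.
Proof. by split=> [/eqmodP/asboolP|ab] //; apply/eqmodP/asboolP. Qed.

Lemma uea_reprP (a : expr) : uea_eq (repr (\pi_uea a)) a.
Proof. by apply/uea_piP; rewrite reprK. Qed.

Lemma uea_quot (x : uea) : exists a, x = \pi_uea a.
Proof. by exists (repr x); rewrite reprK. Qed.

Definition uea_add (x y : uea) : uea := \pi_uea (UAdd (repr x) (repr y)).
Definition uea_mul (x y : uea) : uea := \pi_uea (UMul (repr x) (repr y)).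
Definition uea_scale (c : k) (x : uea) : uea := \pi_uea (UScale c (repr x)).
Definition uea_zero : uea := \pi_uea UZero.
Definition uea_one : uea := \pi_uea UOne.
Definition uea_opp := uea_scale (-1).
Definition uea_gen (x : g) : uea := \pi_uea (UGen x).

Lemma uea_addE a b : uea_add (\pi_uea a) (\pi_uea b) = \pi_uea (UAdd a b).
Proof. by apply/uea_piP; apply: ueq_add; apply: uea_reprP. Qed.

Lemma uea_mulE a b : uea_mul (\pi_uea a) (\pi_uea b) = \pi_uea (UMul a b).
Proof. by apply/uea_piP; apply: ueq_mul; apply: uea_reprP. Qed.

Lemma uea_scaleE c a : uea_scale c (\pi_uea a) = \pi_uea (UScale c a).
Proof. by apply/uea_piP; apply: ueq_scale; apply: uea_reprP. Qed.

Let ueaE := (uea_addE, uea_mulE, uea_scaleE).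

Local Ltac uea_quots :=
  repeat match goal with
  | x : uea |- _ => have [? ->] := uea_quot x; clear x
  end.

Fact uea_addA : associative uea_add.
Proof. move=> x y z; uea_quots; rewrite !ueaE; apply/uea_piP; apply: ueq_addA. Qed.

Fact uea_addC : commutative uea_add.
Proof. move=> x y; uea_quots; rewrite !ueaE; apply/uea_piP; apply: ueq_addC. Qed.

Fact uea_add0 : left_id uea_zero uea_add.
Proof. move=> x; uea_quots; rewrite !ueaE; apply/uea_piP; apply: ueq_add0. Qed.

Fact uea_scaleA c d x : uea_scale c (uea_scale d x) = uea_scale (c * d) x.
Proof. uea_quots; rewrite !ueaE; apply/uea_piP; apply: ueq_scaleA. Qed.

Fact uea_scale1 : left_id 1 uea_scale.
Proof. move=> x; uea_quots; rewrite !ueaE; apply/uea_piP; apply: ueq_scale1. Qed.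

Fact uea_scale0 x : uea_scale 0 x = uea_zero.
Proof. uea_quots; rewrite !ueaE; apply/uea_piP; apply: ueq_scale0. Qed.

Fact uea_scaleDl x c d :
  uea_scale (c + d) x = uea_add (uea_scale c x) (uea_scale d x).
Proof. uea_quots; rewrite !ueaE; apply/uea_piP; apply: ueq_scaleDl. Qed.

Fact uea_addN : left_inverse uea_zero uea_opp uea_add.
Proof.
move=> x; rewrite -[X in uea_add _ X]uea_scale1 -uea_scaleDl addNr.
exact: uea_scale0.
Qed.

HB.instance Definition _ :=
  GRing.isZmodule.Build uea uea_addA uea_addC uea_add0 uea_addN.

Fact uea_scaleDr : right_distributive uea_scale +%R.
Proof.
move=> c x y; uea_quots; rewrite /GRing.add /= !ueaE; apply/uea_piP; apply: ueq_scaleDr.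
Qed.

HB.instance Definition _ := GRing.Zmodule_isLmodule.Build k uea
  uea_scaleA uea_scale1 uea_scaleDr uea_scaleDl.

Fixpoint expr_eval (M : lmodType k) (mul : M -> M -> M) (one : M)
    (f : g -> M) (a : expr) : M :=
  match a with
  | UGen x => f x
  | UOne => one
  | UZero => 0
  | UAdd a b => expr_eval mul one f a + expr_eval mul one f b
  | UMul a b => mul (expr_eval mul one f a) (expr_eval mul one f b)
  | UScale c a => c *: expr_eval mul one f a
  end.

(* The map given by the universal property; it only makes sense when
   (M, mul, one) is an algebra and f maps brackets to commutators. *)
Definition uea_lift (M : lmodType k) (mul : M -> M -> M) (one : M)
    (f : g -> M) (u : uea) : M := expr_eval mul one f (repr u).

Section UniversalProperty.
Variables (M : lmodType k) (mul : M -> M -> M) (one : M) (f : g -> M).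
Hypothesis M_alg : is_algebra mul one.
Hypothesis f_lin : linear f.
Hypothesis f_br : forall x y, f (lie_br x y) = mul (f x) (f y) - mul (f y) (f x).
Local Notation lift := (uea_lift mul one f).

Lemma expr_eval_eq a b : uea_eq a b ->
  expr_eval mul one f a = expr_eval mul one f b.
Proof.
have [mul_bil mulA mul1l mul1r] := M_alg.
elim=> //=.
- by move=> {}a {}b c _ -> _ ->.
- by move=> {}a a' {}b b' _ -> _ ->.
- by move=> {}a a' {}b b' _ -> _ ->.
- by move=> c {}a {}b _ ->.
- by move=> *; rewrite addrA.
- by move=> *; rewrite addrC.
- by move=> *; rewrite add0r.
- by move=> *; rewrite scalerA.
- by move=> *; rewrite scale1r.
- by move=> *; rewrite scale0r.
- by move=> *; rewrite scalerDl.
- by move=> *; rewrite scalerDr.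
- by move=> *; rewrite (bilDl mul_bil).
- by move=> *; rewrite (bilDr mul_bil).
- by move=> *; rewrite (bilZl mul_bil).
- by move=> *; rewrite (bilZr mul_bil).
- by move=> x y; rewrite f_br addrCA subrr addr0.
Qed.

Lemma uea_lift_pi a : lift (\pi_uea a) = expr_eval mul one f a.
Proof. exact/expr_eval_eq/uea_reprP. Qed.

Lemma uea_lift_gen x : lift (uea_gen x) = f x.
Proof. exact: uea_lift_pi. Qed.

Lemma uea_lift_one : lift uea_one = one.
Proof. exact: uea_lift_pi. Qed.

Lemma uea_lift_mul u v : lift (uea_mul u v) = mul (lift u) (lift v).
Proof. by uea_quots; rewrite ueaE !uea_lift_pi. Qed.

Lemma uea_lift_linear : linear lift.
Proof.
move=> c u v; have [a ->] := uea_quot u; have [b ->] := uea_quot v.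
rewrite [_ *: _]uea_scaleE [_ + _]uea_addE.
by rewrite !uea_lift_pi.
Qed.

End UniversalProperty.

Fact regular_is_algebra : is_algebra (A := k^o) *%R 1.
Proof.
split; [split=> ? ? ? ? | exact: mulrA | exact: mul1r | exact: mulr1].
- by rewrite mulrDl -scalerAl.
- by rewrite mulrDr -scalerAr.
Qed.

Definition uea_counit : uea -> k := uea_lift (M := k^o) *%R 1 (fun=> 0).

Fact counit_br (x y : g) : 0 = 0 * 0 - 0 * 0 :> k^o.
Proof. by rewrite subrr. Qed.

Fact zero_linear (M : lmodType k) : linear (fun _ : g => 0 : M).
Proof. by move=> c x y; rewrite scaler0 addr0. Qed.

Fact uea_mulA : associative uea_mul.
Proof. move=> x y z; uea_quots; rewrite !ueaE; apply/uea_piP; apply: ueq_mulA. Qed.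

Fact uea_mul1l : left_id uea_one uea_mul.
Proof. move=> x; uea_quots; rewrite !ueaE; apply/uea_piP; apply: ueq_mul1l. Qed.

Fact uea_mul1r : right_id uea_one uea_mul.
Proof. move=> x; uea_quots; rewrite !ueaE; apply/uea_piP; apply: ueq_mul1r. Qed.

Fact uea_mulDl : left_distributive uea_mul +%R.
Proof.
move=> x y z; uea_quots; rewrite /GRing.add /= !ueaE; apply/uea_piP; apply: ueq_mulDl.
Qed.

Fact uea_mulDr : right_distributive uea_mul +%R.
Proof.
move=> x y z; uea_quots; rewrite /GRing.add /= !ueaE; apply/uea_piP; apply: ueq_mulDr.
Qed.

Fact uea_one_neq0 : uea_one != 0.
Proof.
apply/eqP=> e10; have /eqP := oner_neq0 k; apply.
have := uea_lift_one regular_is_algebra (@zero_linear k^o) counit_br.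
rewrite e10 => <-.
exact: (uea_lift_pi regular_is_algebra (@zero_linear k^o) counit_br UZero).
Qed.

HB.instance Definition _ := GRing.Zmodule_isNzRing.Build uea
  uea_mulA uea_mul1l uea_mul1r uea_mulDl uea_mulDr uea_one_neq0.

Fact uea_scaleAl (c : k) (x y : uea) : c *: (x * y) = c *: x * y.
Proof.
uea_quots; rewrite /GRing.scale /GRing.mul /= !ueaE; apply/uea_piP; apply: ueq_scaleAl.
Qed.

Fact uea_scaleAr (c : k) (x y : uea) : c *: (x * y) = x * (c *: y).
Proof.
uea_quots; rewrite /GRing.scale /GRing.mul /= !ueaE; apply/uea_piP; apply: ueq_scaleAr.
Qed.

HB.instance Definition _ := GRing.Lmodule_isLalgebra.Build k uea uea_scaleAl.
HB.instance Definition _ := GRing.Lalgebra_isAlgebra.Build k uea uea_scaleAr.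

End UniversalEnvelopingAlgebra.

Section TensorTheory.
Variable k : fieldType.
Implicit Types M A B U V W : lmodType k.

Lemma linD U V (f : U -> V) : linear f -> forall x y, f (x + y) = f x + f y.
Proof. by move=> lf x y; have := lf 1 x y; rewrite !scale1r. Qed.

Lemma linZ U V (f : U -> V) : linear f -> forall a x, f (a *: x) = a *: f x.
Proof. by move=> lf a x; apply: (scalable_linear lf). Qed.

Lemma lin0 U V (f : U -> V) : linear f -> f 0 = 0.
Proof. by move=> lf; rewrite -(scale0r 0) (linZ lf) !scale0r. Qed.

Lemma bil0l U V W (f : U -> V -> W) : bilinear_map f -> forall v, f 0 v = 0.
Proof. by move=> bf v; rewrite -(scale0r 0) (bilZl bf) !scale0r. Qed.

Lemma bil0r U V W (f : U -> V -> W) : bilinear_map f -> forall u, f u 0 = 0.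
Proof. by move=> bf v; rewrite -(scale0r 0) (bilZr bf) !scale0r. Qed.

Lemma tens_ind V W (P : tens V W -> Prop) :
  P 0 -> (forall v w, P (tensor v w)) ->
  (forall x y, P x -> P y -> P (x + y)) -> forall t, P t.
Proof.
move=> P0 P1 PD t; rewrite [t]tens_sumE.
by elim/big_ind: _ => // p _; apply: P1.
Qed.

Lemma tlift_bilinear U V V' W' M (G : U -> V -> V' -> W' -> M)
    (t : tens V' W') :
  (forall v' w', bilinear_map (fun u v => G u v v' w')) ->
  bilinear_map (fun u v => tlift (G u v) t).
Proof.
move=> bG; split=> [v a u u'|u a v v']; rewrite /tlift scaler_sumr -big_split;
  apply: eq_bigr => p _ /=; by [rewrite ((bG _ _).1 v) | rewrite ((bG _ _).2 u)].
Qed.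

Lemma tmap_bilinear V W V' W' (f : V -> V') (g : W -> W') :
  linear f -> linear g -> bilinear_map (fun v w => tensor (f v) (g w)).
Proof.
move=> lf lg; split=> [w a v v'|v a w w'].
  by rewrite lf (bilDl (tensor_bilinear _ _)) (bilZl (tensor_bilinear _ _)).
by rewrite lg (bilDr (tensor_bilinear _ _)) (bilZr (tensor_bilinear _ _)).
Qed.

Lemma tmap_tensor V W V' W' (f : V -> V') (g : W -> W') v w :
  linear f -> linear g -> tmap f g (tensor v w) = tensor (f v) (g w).
Proof. by move=> lf lg; rewrite /tmap tlift_tensor //; apply: tmap_bilinear. Qed.

Lemma tmap_linear V W V' W' (f : V -> V') (g : W -> W') :
  linear f -> linear g -> linear (tmap f g).
Proof. by move=> lf lg; apply/tlift_linear/tmap_bilinear. Qed.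

Lemma tassoc_bil_in U V W (w : W) :
  bilinear_map (fun (u : U) (v : V) => tensor u (tensor v w)).
Proof.
have bt U' V' := tensor_bilinear (k := k) U' V'.
split=> [v a u u'|u a v v']; first by rewrite (bilDl (bt _ _)) (bilZl (bt _ _)).
by rewrite (bilDl (bt _ _)) (bilZl (bt _ _)) (bilDr (bt _ _)) (bilZr (bt _ _)).
Qed.

Lemma tassoc_bil U V W :
  bilinear_map (fun (uv : tens U V) (w : W) =>
    tlift (fun u v => tensor u (tensor v w)) uv).
Proof.
have bt U' V' := tensor_bilinear (k := k) U' V'.
split=> [w|uv a w w']; first exact/tlift_linear/tassoc_bil_in.
rewrite /tlift scaler_sumr -big_split; apply: eq_bigr => p _ /=.
by rewrite 2!(bilDr (bt _ _)) 2!(bilZr (bt _ _)).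
Qed.

Lemma tassoc_tensor U V W (u : U) (v : V) (w : W) :
  tassoc (tensor (tensor u v) w) = tensor u (tensor v w).
Proof.
rewrite /tassoc tlift_tensor; last exact: tassoc_bil.
by rewrite tlift_tensor //; apply: tassoc_bil_in.
Qed.

Lemma tassoc_linear U V W : linear (@tassoc k U V W).
Proof. exact/tlift_linear/tassoc_bil. Qed.

Section TensorAlgebra.
Variables (A B : lmodType k) (mulA : A -> A -> A) (mulB : B -> B -> B).
Variables (oneA : A) (oneB : B).
Hypotheses (algA : is_algebra mulA oneA) (algB : is_algebra mulB oneB).

Let bt := tensor_bilinear A B.
Let bA := alg_bilinear algA.
Let bB := alg_bilinear algB.

Lemma tens_mul_bil1 (a : A) (b : B) :
  bilinear_map (fun a' b' => tensor (mulA a a') (mulB b b')).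
Proof. exact: tmap_bilinear (bA.2 a) (bB.2 b). Qed.

Lemma tens_mul_bil2 t :
  bilinear_map (fun a b =>
    tlift (fun a' b' => tensor (mulA a a') (mulB b b')) t).
Proof.
by apply: tlift_bilinear => a' b'; apply: tmap_bilinear (bA.1 a') (bB.1 b').
Qed.

Lemma tens_mul_bilinear : bilinear_map (tens_mul mulA mulB).
Proof.
split=> [t|s a t t']; first exact/tlift_linear/tens_mul_bil2.
rewrite /tens_mul /(tlift _ s) scaler_sumr -big_split; apply: eq_bigr => p _ /=.
exact: (tlift_linear (tens_mul_bil1 p.1 p.2)).
Qed.

Lemma tens_mul_tensor a b a' b' :
  tens_mul mulA mulB (tensor a b) (tensor a' b')
  = tensor (mulA a a') (mulB b b').
Proof.
rewrite /tens_mul tlift_tensor; last exact: tens_mul_bil2.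
by rewrite tlift_tensor //; apply: tens_mul_bil1.
Qed.

Let bm := tens_mul_bilinear.

Lemma tens_mul_is_algebra :
  is_algebra (tens_mul mulA mulB) (tensor oneA oneB).
Proof.
split=> [|x y z|x|x]; first exact: bm.
- elim/tens_ind: x => [|a b|x x' IHx IHx']; rewrite ?(bil0l bm) //.
    elim/tens_ind: y => [|c d|y y' IHy IHy'].
    + by rewrite (bil0r bm) !(bil0l bm) (bil0r bm).
    + elim/tens_ind: z => [|e f|z z' IHz IHz']; first by rewrite !(bil0r bm).
        by rewrite !tens_mul_tensor (alg_mulA algA) (alg_mulA algB).
      by rewrite !(bilDr bm) IHz IHz'.
    + by rewrite (bilDl bm) !(bilDr bm) (bilDl bm) IHy IHy'.
  by rewrite !(bilDl bm) IHx IHx'.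
- elim/tens_ind: x => [|a b|x x' IHx IHx']; first by rewrite (bil0r bm).
    by rewrite tens_mul_tensor (alg_mul1l algA) (alg_mul1l algB).
  by rewrite (bilDr bm) IHx IHx'.
- elim/tens_ind: x => [|a b|x x' IHx IHx']; first by rewrite (bil0l bm).
    by rewrite tens_mul_tensor (alg_mul1r algA) (alg_mul1r algB).
  by rewrite (bilDl bm) IHx IHx'.
Qed.

(* A linear map out of a tensor product of algebras is multiplicative as soon
   as it is so on pure tensors. *)
Lemma tens_multiplicative M (mul : M -> M -> M) (F : tens A B -> M) :
  bilinear_map mul -> linear F ->
  (forall a b a' b', F (tens_mul mulA mulB (tensor a b) (tensor a' b'))
                     = mul (F (tensor a b)) (F (tensor a' b'))) ->
  forall s t, F (tens_mul mulA mulB s t) = mul (F s) (F t).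
Proof.
move=> b lF FM s t; elim/tens_ind: s => [|a b'|s s' IHs IHs'].
- by rewrite (bil0l bm) (lin0 lF) (bil0l b).
- elim/tens_ind: t => [|c d|t t' IHt IHt']; last 2 first.
  + exact: FM.
  + by rewrite (bilDr bm) !(linD lF) (bilDr b) IHt IHt'.
  by rewrite (bil0r bm) (lin0 lF) (bil0r b).
- by rewrite (bilDl bm) !(linD lF) (bilDl b) IHs IHs'.
Qed.

End TensorAlgebra.

End TensorTheory.

Section EnvelopingHopfAlgebra.
Variables (k : fieldType) (g : lie_algebra k).
Local Notation U := (uea g).
Local Notation mulU := (@GRing.mul U).
Local Notation gen := (@uea_gen k g).

Lemma uea_ind (P : U -> Prop) :
  (forall x, P (gen x)) -> P 1 -> (forall u v, P u -> P v -> P (u + v)) ->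
  (forall u v, P u -> P v -> P (u * v)) -> (forall c u, P u -> P (c *: u)) ->
  forall u, P u.
Proof.
move=> Pg P1 PD PM PZ u; have [a ->] := uea_quot u; elim: a => //.
- by have := PZ 0 1 P1; rewrite scale0r.
- by move=> a Pa b Pb; rewrite -uea_addE; apply: PD.
- by move=> a Pa b Pb; rewrite -uea_mulE; apply: PM.
- by move=> c a Pa; rewrite -uea_scaleE; apply: PZ.
Qed.

Lemma uea_gen_linear : linear gen.
Proof.
move=> c x y; rewrite [c *: gen x]uea_scaleE [RHS]uea_addE.
by apply/uea_piP/ueq_gen.
Qed.

Lemma uea_gen_br x y : gen (lie_br x y) = gen x * gen y - gen y * gen x.
Proof.
apply/eqP; rewrite eq_sym subr_eq addrC; apply/eqP.
rewrite /GRing.mul /= /uea_gen !uea_mulE [_ + _]uea_addE.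
exact/uea_piP/ueq_br.
Qed.

Fact uea_is_algebra : is_algebra mulU 1.
Proof.
split; [split=> [v a u u'|u a v v'] | exact: mulrA | exact: mul1r | exact: mulr1].
- by rewrite mulrDl scalerAl.
- by rewrite mulrDr scalerAr.
Qed.

Fact uea_opp_is_algebra : is_algebra (fun u v : U => v * u) 1.
Proof.
split=> [||u|u]; [split=> [v a u u'|u a v v'] | | exact: mulr1 | exact: mul1r].
- by rewrite mulrDr scalerAr.
- by rewrite mulrDl scalerAl.
- by move=> u v w; rewrite mulrA.
Qed.

Let bt := tensor_bilinear U U.
Let algUU := tens_mul_is_algebra uea_is_algebra uea_is_algebra.
Local Notation mulUU := (tens_mul mulU mulU).
Let bUU : bilinear_map mulUU := alg_bilinear algUU.

Definition uea_coprod_gen (x : g) : tens U U :=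
  tensor (gen x) 1 + tensor 1 (gen x).

(* The coshuffle coproduct. *)
Definition uea_coprod : U -> tens U U :=
  uea_lift (tens_mul mulU mulU) (tensor 1 1) uea_coprod_gen.

Definition uea_antipode : U -> U :=
  uea_lift (fun u v : U => v * u) 1 (fun x => - gen x).

Fact coprod_gen_linear : linear uea_coprod_gen.
Proof.
move=> c x y; rewrite /uea_coprod_gen uea_gen_linear.
rewrite (bilDl bt) (bilDr bt) (bilZl bt) (bilZr bt) scalerDr.
by rewrite -!addrA; congr (_ + _); rewrite addrCA.
Qed.

Fact coprod_gen_br x y : uea_coprod_gen (lie_br x y) =
  mulUU (uea_coprod_gen x) (uea_coprod_gen y)
  - mulUU (uea_coprod_gen y) (uea_coprod_gen x).
Proof.
rewrite /uea_coprod_gen uea_gen_br !(bilDl bUU) !(bilDr bUU).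
rewrite !(tens_mul_tensor uea_is_algebra uea_is_algebra).
rewrite !mul1r !mulr1 (bilDl bt) (bilDr bt) (bilNl bt) (bilNr bt).
apply/eqP; rewrite -subr_eq0; apply/eqP; by zmod_cancel.
Qed.

Fact antipode_gen_linear : linear (fun x => - gen x).
Proof. by move=> c x y; rewrite uea_gen_linear opprD scalerN. Qed.

Fact antipode_gen_br x y :
  - gen (lie_br x y) = - gen y * - gen x - - gen x * - gen y.
Proof. by rewrite uea_gen_br !mulrNN opprB. Qed.

Lemma coprod_gen x : uea_coprod (gen x) = tensor (gen x) 1 + tensor 1 (gen x).
Proof. exact: (uea_lift_gen algUU coprod_gen_linear coprod_gen_br). Qed.

Lemma coprod1 : uea_coprod 1 = tensor 1 1.
Proof. exact: (uea_lift_one algUU coprod_gen_linear coprod_gen_br). Qed.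

Lemma coprodM u v : uea_coprod (u * v) = mulUU (uea_coprod u) (uea_coprod v).
Proof. exact: (uea_lift_mul algUU coprod_gen_linear coprod_gen_br). Qed.

Lemma coprod_linear : linear uea_coprod.
Proof. exact: (uea_lift_linear algUU coprod_gen_linear coprod_gen_br). Qed.

Let reg := regular_is_algebra k.
Let z_lin := @zero_linear k g k^o.
Let z_br := @counit_br k g.

Lemma counit_gen x : uea_counit (gen x) = 0.
Proof. exact: (uea_lift_gen reg z_lin z_br). Qed.

Lemma counit1 : uea_counit (1 : U) = 1.
Proof. exact: (uea_lift_one reg z_lin z_br). Qed.

Lemma counitM (u v : U) : uea_counit (u * v) = uea_counit u * uea_counit v.
Proof. exact: (uea_lift_mul reg z_lin z_br). Qed.

Lemma counit_linear : scalar (@uea_counit k g).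
Proof. exact: (uea_lift_linear reg z_lin z_br). Qed.

Let opU := uea_opp_is_algebra.

Lemma antipode_gen x : uea_antipode (gen x) = - gen x.
Proof. exact: (uea_lift_gen opU antipode_gen_linear antipode_gen_br). Qed.

Lemma antipode1 : uea_antipode 1 = 1.
Proof. exact: (uea_lift_one opU antipode_gen_linear antipode_gen_br). Qed.

Lemma antipodeM u v : uea_antipode (u * v) = uea_antipode v * uea_antipode u.
Proof. exact: (uea_lift_mul opU antipode_gen_linear antipode_gen_br). Qed.

Lemma antipode_linear : linear uea_antipode.
Proof. exact: (uea_lift_linear opU antipode_gen_linear antipode_gen_br). Qed.


Let aU := uea_is_algebra.
Let bU := alg_bilinear aU.
Let id_lin : linear (@id U). Proof. by []. Qed.

Lemma uea_coassoc u :
  tassoc (tmap uea_coprod id (uea_coprod u))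
  = tmap id uea_coprod (uea_coprod u).
Proof.
have aUUU := tens_mul_is_algebra aU algUU.
have bUUU := alg_bilinear aUUU.
have bUU_U := alg_bilinear (tens_mul_is_algebra algUU aU).
have lD := coprod_linear.
have l1 := tmap_linear lD id_lin; have l2 := tmap_linear id_lin lD.
have la := @tassoc_linear k U U U.
have tl V W := bilDl (tensor_bilinear (k := k) V W).
have tr V W := bilDr (tensor_bilinear (k := k) V W).
elim/uea_ind: u => [x||u v IHu IHv|u v IHu IHv|c u IHu].
- rewrite coprod_gen (linD l1) (linD l2) !tmap_tensor // coprod_gen coprod1.
  by rewrite tl !(linD la) !tassoc_tensor tr addrA.
- by rewrite coprod1 !tmap_tensor // coprod1 tassoc_tensor.
- by rewrite (linD lD) (linD l1) (linD l2) (linD la) IHu IHv.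
- pose m3 := tens_mul mulU mulUU.
  have M1 : forall s t, tassoc (tmap uea_coprod id (mulUU s t))
      = m3 (tassoc (tmap uea_coprod id s)) (tassoc (tmap uea_coprod id t)).
    move=> s t; rewrite (tens_multiplicative aU aU bUU_U l1) => [|a b a' b'].
      apply: (tens_multiplicative algUU aU bUUU la) => ab c ab' c'.
      rewrite (tens_mul_tensor algUU aU).
      elim/tens_ind: ab => [|a b|x y IHx IHy].
      + rewrite (bil0l bUU) !(bil0l (tensor_bilinear _ _)) !(lin0 la).
        by rewrite (bil0l bUUU).
      + elim/tens_ind: ab' => [|a' b'|x y IHx IHy].
        * rewrite (bil0r bUU) !(bil0l (tensor_bilinear _ _)) !(lin0 la).
          by rewrite (bil0r bUUU).
        * rewrite (tens_mul_tensor aU aU) !tassoc_tensor.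
          by rewrite (tens_mul_tensor aU algUU) (tens_mul_tensor aU aU).
        * by rewrite (bilDr bUU) !tl !(linD la) IHx IHy (bilDr bUUU).
      + by rewrite (bilDl bUU) !tl !(linD la) IHx IHy (bilDl bUUU).
    rewrite (tens_mul_tensor aU aU) !tmap_tensor //.
    by rewrite (tens_mul_tensor algUU aU) coprodM.
  have M2 : forall s t, tmap id uea_coprod (mulUU s t)
      = m3 (tmap id uea_coprod s) (tmap id uea_coprod t).
    apply: (tens_multiplicative aU aU bUUU l2) => a b a' b'.
    rewrite (tens_mul_tensor aU aU) !tmap_tensor //.
    by rewrite (tens_mul_tensor aU algUU) coprodM.
  by rewrite coprodM M1 M2 IHu IHv.
- by rewrite (linZ lD) (linZ l1) (linZ l2) (linZ la) IHu.
Qed.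

Lemma counitl_bilinear :
  bilinear_map (fun a1 a2 : U => uea_counit a1 *: a2).
Proof.
split=> [v a u u'|u a v v'].
  by rewrite counit_linear scalerDl scalerA.
by rewrite scalerDr !scalerA mulrC.
Qed.

Lemma counitr_bilinear :
  bilinear_map (fun a1 a2 : U => uea_counit a2 *: a1).
Proof. by have [bl br] := counitl_bilinear; split. Qed.

Lemma uea_counitl u : tlift (fun a1 a2 => uea_counit a1 *: a2) (uea_coprod u) = u.
Proof.
have b := counitl_bilinear; have l := tlift_linear b; have lD := coprod_linear.
elim/uea_ind: u => [x||u v IHu IHv|u v IHu IHv|c u IHu].
- rewrite coprod_gen (linD l) !tlift_tensor // counit_gen counit1.
  by rewrite scale0r add0r scale1r.
- by rewrite coprod1 tlift_tensor // counit1 scale1r.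
- by rewrite (linD lD) (linD l) IHu IHv.
- rewrite coprodM (tens_multiplicative aU aU bU l) ?IHu ?IHv // => a c a' c'.
  rewrite (tens_mul_tensor aU aU) !tlift_tensor // counitM.
  by rewrite -scalerAl -scalerAr scalerA.
- by rewrite (linZ lD) (linZ l) IHu.
Qed.

Lemma uea_counitr u : tlift (fun a1 a2 => uea_counit a2 *: a1) (uea_coprod u) = u.
Proof.
have b := counitr_bilinear; have l := tlift_linear b; have lD := coprod_linear.
elim/uea_ind: u => [x||u v IHu IHv|u v IHu IHv|c u IHu].
- rewrite coprod_gen (linD l) !tlift_tensor // counit_gen counit1.
  by rewrite scale0r addr0 scale1r.
- by rewrite coprod1 tlift_tensor // counit1 scale1r.
- by rewrite (linD lD) (linD l) IHu IHv.
- rewrite coprodM (tens_multiplicative aU aU bU l) ?IHu ?IHv // => a c a' c'.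
  rewrite (tens_mul_tensor aU aU) !tlift_tensor // counitM.
  by rewrite -scalerAl -scalerAr scalerA.
- by rewrite (linZ lD) (linZ l) IHu.
Qed.

Lemma antipodel_bilinear (a d : U) :
  bilinear_map (fun a1 a2 : U => a * (uea_antipode a1 * a2) * d).
Proof.
split=> [v c u u'|u c v v'].
  rewrite antipode_linear mulrDl mulrDr mulrDl.
  by rewrite -scalerAl -scalerAr -scalerAl.
by rewrite mulrDr mulrDr mulrDl -scalerAr -scalerAr -scalerAl.
Qed.

Lemma antipoder_bilinear (a d : U) :
  bilinear_map (fun a1 a2 : U => a * (a1 * uea_antipode a2) * d).
Proof.
split=> [v c u u'|u c v v'].
  by rewrite mulrDl mulrDr mulrDl -scalerAl -scalerAr -scalerAl.
rewrite antipode_linear mulrDr mulrDr mulrDl.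
by rewrite -scalerAr -scalerAr -scalerAl.
Qed.

Let antil (t : tens U U) : U := tlift (fun a1 a2 => uea_antipode a1 * a2) t.
Let antir (t : tens U U) : U := tlift (fun a1 a2 => a1 * uea_antipode a2) t.

Fact antil_bil : bilinear_map (fun a1 a2 : U => uea_antipode a1 * a2).
Proof.
have [bl br] := antipodel_bilinear 1 1.
by split=> [v c u u'|u c v v']; [have := bl v c u u' | have := br u c v v'];
  rewrite !mul1r !mulr1.
Qed.

Fact antir_bil : bilinear_map (fun a1 a2 : U => a1 * uea_antipode a2).
Proof.
have [bl br] := antipoder_bilinear 1 1.
by split=> [v c u u'|u c v v']; [have := bl v c u u' | have := br u c v v'];
  rewrite !mul1r !mulr1.
Qed.

Fact antil_mul s c d : antil (mulUU s (tensor c d))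
  = uea_antipode c * antil s * d.
Proof.
have l : linear antil := tlift_linear antil_bil.
elim/tens_ind: s => [|a b|s s' IHs IHs'].
- by rewrite (bil0l bUU) (lin0 l) mulr0 mul0r.
- rewrite (tens_mul_tensor aU aU) /antil !tlift_tensor; try exact: antil_bil.
  by rewrite antipodeM !mulrA.
- by rewrite (bilDl bUU) !(linD l) mulrDr mulrDl -IHs -IHs'.
Qed.

Fact antir_mul c d t : antir (mulUU (tensor c d) t)
  = c * antir t * uea_antipode d.
Proof.
have l : linear antir := tlift_linear antir_bil.
elim/tens_ind: t => [|a b|t t' IHt IHt'].
- by rewrite (bil0r bUU) (lin0 l) mulr0 mul0r.
- rewrite (tens_mul_tensor aU aU) /antir !tlift_tensor; try exact: antir_bil.
  by rewrite antipodeM !mulrA.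
- by rewrite (bilDr bUU) !(linD l) mulrDr mulrDl -IHt -IHt'.
Qed.

Lemma uea_antipodel u :
  tlift (fun a1 a2 => uea_antipode a1 * a2) (uea_coprod u)
  = uea_counit u *: (1 : U).
Proof.
rewrite -/(antil _); have b := antil_bil; have lD := coprod_linear.
have l : linear antil := tlift_linear b.
elim/uea_ind: u => [x||u v IHu IHv|u v IHu IHv|c u IHu].
- rewrite coprod_gen (linD l) /antil !tlift_tensor // antipode_gen antipode1.
  by rewrite counit_gen scale0r mulr1 mul1r addNr.
- by rewrite coprod1 /antil tlift_tensor // counit1 antipode1 mul1r scale1r.
- rewrite (linD lD) (linD l) IHu IHv.
  by have := counit_linear 1 u v; rewrite scale1r mul1r => ->; rewrite scalerDl.
- rewrite coprodM counitM.
  have -> : forall t, antil (mulUU (uea_coprod u) t) = uea_counit u *: antil t.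
    elim/tens_ind=> [|c d|t t' IHt IHt'].
    + by rewrite (bil0r bUU) (lin0 l) scaler0.
    + rewrite antil_mul IHu /antil tlift_tensor //.
      by rewrite -scalerAr mulr1 -scalerAl.
    + by rewrite (bilDr bUU) !(linD l) IHt IHt' scalerDr.
  by rewrite IHv scalerA.
- rewrite (linZ lD) (linZ l) IHu scalerA.
  by have /= -> := scalable_linear counit_linear c u.
Qed.

Lemma uea_antipoder u :
  tlift (fun a1 a2 => a1 * uea_antipode a2) (uea_coprod u)
  = uea_counit u *: (1 : U).
Proof.
rewrite -/(antir _); have b := antir_bil; have lD := coprod_linear.
have l : linear antir := tlift_linear b.
elim/uea_ind: u => [x||u v IHu IHv|u v IHu IHv|c u IHu].
- rewrite coprod_gen (linD l) /antir !tlift_tensor // antipode_gen antipode1.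
  by rewrite counit_gen scale0r mulr1 mul1r subrr.
- by rewrite coprod1 /antir tlift_tensor // counit1 antipode1 mul1r scale1r.
- rewrite (linD lD) (linD l) IHu IHv.
  by have := counit_linear 1 u v; rewrite scale1r mul1r => ->; rewrite scalerDl.
- rewrite coprodM counitM.
  have -> : forall s, antir (mulUU s (uea_coprod v)) = uea_counit v *: antir s.
    elim/tens_ind=> [|c d|t t' IHt IHt'].
    + by rewrite (bil0l bUU) (lin0 l) scaler0.
    + rewrite antir_mul IHv /antir tlift_tensor //.
      by rewrite -scalerAr mulr1 -scalerAl.
    + by rewrite (bilDl bUU) !(linD l) IHt IHt' scalerDr.
  by rewrite IHu scalerA mulrC.
- rewrite (linZ lD) (linZ l) IHu scalerA.
  by have /= -> := scalable_linear counit_linear c u.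
Qed.

Lemma uea_is_hopf_algebra :
  is_hopf_algebra mulU 1 uea_coprod (@uea_counit k g) uea_antipode.
Proof.
split.
- exact: uea_is_algebra.
- exact: coprod_linear.
- exact: counit_linear.
- exact: antipode_linear.
- exact: uea_coassoc.
- exact: uea_counitl.
- exact: uea_counitr.
- exact: coprod1.
- exact: coprodM.
- exact: counit1.
- exact: counitM.
- exact: uea_antipodel.
- exact: uea_antipoder.
Qed.

Definition uea_hopf : hopf_algebra k := HopfAlgebra uea_is_hopf_algebra.

End EnvelopingHopfAlgebra.

Section PostLieExtension.
Variables (k : fieldType) (P : post_lie_algebra k).
Local Notation U := (uea P).
Local Notation gen := (@uea_gen k P).

Record is_post_lie_extension (tri : U -> U -> U) : Prop := IsPostLieExtension {
  ext_bilinear : bilinear_map tri;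
  ext_gen : forall x y : P, tri (gen x) (gen y) = gen (pl_tri x y);
  ext_one : forall A, tri 1 A = A;
  ext_mull : forall (x y : P) A,
    tri (gen x * A) (gen y)
    = tri (gen x) (tri A (gen y)) - tri (tri (gen x) A) (gen y);
  ext_mulr : forall A B C,
    tri A (B * C) = tlift (fun A1 A2 => tri A1 B * tri A2 C) (uea_coprod A)
}.

Definition star (tri : U -> U -> U) (A B : U) : U :=
  tlift (fun A1 A2 => A1 * tri A2 B) (uea_coprod A).

End PostLieExtension.

(* Main.v *)
Require Import Defs.
From HB Require Import structures.
From mathcomp Require Import all_boot all_algebra.
From mathcomp Require Import boolp functions.

Set Implicit Arguments.
Unset Strict Implicit.
Unset Printing Implicit Defensive.

Import GRing.Theory.
Local Open Scope ring_scope.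

(** The theorem compares two ways of letting a Lie algebra act. Write g for the
    Lie algebra of P, gbar for its sub-adjacent Lie algebra, and U, V for their
    enveloping algebras.

    A generator x acts on U by A |-> x A + x |> A. As x |> _ is a derivation,
    the commutator of two such operators is the operator of the sub-adjacent
    bracket, so this is a representation of gbar, and the orbit of 1 is a linear
    map Phi : V -> U with Phi (x A) = x Phi A + x |> Phi A. Since
    x * B = x B + x |> B, this Phi is the only candidate for an isomorphism of
    V onto U with the product *.

    Phi is bijective (star_gen_orbit_bijective). This is usually deduced from
    the Poincare-Birkhoff-Witt theorem, through the associated graded algebras;
    here an inverse is constructed in the same way as Phi. The operators that
    x |> _ should induce on V can be described within V: they are the D_x with
      D_x 1 = 0,  D_x (y A) = (x |> y) A + y (D_x A) - D_(x') A
    where x' = y |> x + [y, x] (twisted_derivation_exists). The operators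
    A |-> x A - D_x A then represent g on V (twisted_mul_rep), and the orbit
    of 1 is a linear map Psi : U -> V. An induction on left multiplication by
    generators shows that Phi and Psi exchange x |> _ and D_x, hence that they
    are inverse to each other.

    Phi is compatible with the structures. The operator x |> _ is a coderivation
    killed by the counit, so Phi respects the coproduct (orbit_coprod) and the
    counit (orbit_counit). For the product, the point is that
      (x B) |> C = x |> (B |> C) - (x |> B) |> C
    holds for all C in U and not only for generators (tri_gen_mull); it gives
    (x * B) * C = x * (B * C) (star_gen_mull), and Phi (A B) = Phi A * Phi B
    follows by induction on A (orbit_star). The base case C = 1 of the identity
    above requires A |> 1 = eps A (tri1): the map A |-> A |> 1 is idempotent for
    convolution and sends 1 to 1, and in a connected bialgebra only the counit
    has these two properties.

    All the axioms of a Hopf algebra, the associativity of * and the antipode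
    included, are finally transported from V along Phi (hopf_transport). *)

(** * Linear maps and representations of enveloping algebras *)

(** Equality in an abelian group, up to cancellation of opposite terms. *)
Ltac zmod_eq := apply/eqP; rewrite -subr_eq0; apply/eqP; zmod_cancel.

Section LinearAux.
Variable k : fieldType.

Lemma linN (A B : lmodType k) (f : A -> B) :
  linear f -> forall u, f (- u) = - f u.
Proof. by move=> lf u; rewrite -scaleN1r (linZ lf) scaleN1r. Qed.

Lemma pair_ext (A B : Type) (p q : A * B) : p.1 = q.1 -> p.2 = q.2 -> p = q.
Proof. by case: p q => [a b] [c d] /= -> ->. Qed.

End LinearAux.

Section LinearMaps.
Variables (k : fieldType) (V W : lmodType k).

Definition linear_fun : {pred V -> W} := [pred f : V -> W | `[< linear f >]].

Fact linear_fun_closed : submod_closed linear_fun.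
Proof.
split=> [|c f g]; rewrite !inE.
  by apply/asboolP => a u v /=; rewrite scaler0 addr0.
move=> /asboolP lf /asboolP lg; apply/asboolP => a u v.
rewrite [LHS]/(c *: f (a *: u + v) + g (a *: u + v)) lf lg.
rewrite [X in _ = _ + X]/(c *: f v + g v).
rewrite [X in _ = a *: X + _]/(c *: f u + g u).
by rewrite !scalerDr !scalerA (mulrC c a) addrACA.
Qed.

HB.instance Definition _ :=
  GRing.isSubmodClosed.Build k (V -> W)%type linear_fun linear_fun_closed.

(** The linear maps form a k-vector space, so that End(M) can be the target
    algebra of the universal property of an enveloping algebra. *)
Record linmap := Linmap { linmap_fun :> V -> W; _ : linear_fun linmap_fun }.
HB.instance Definition _ := [isSub for linmap_fun].
HB.instance Definition _ := [Choice of linmap by <:].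
HB.instance Definition _ := [SubChoice_isSubLmodule of linmap by <:].

Lemma linmap_linear (f : linmap) : linear f.
Proof. by case: f => f /= /asboolP. Qed.

Definition mk_linmap (f : V -> W) (lf : linear f) : linmap :=
  @Linmap f (introT (asboolP _) lf).

Lemma linmap_ext (f g : linmap) : f =1 g -> f = g.
Proof. by move=> fg; apply/val_inj/funext. Qed.

End LinearMaps.

Section Representations.
Variables (k : fieldType) (g : lie_algebra k) (M : lmodType k).

Record is_lie_rep (rho : g -> M -> M) : Prop := IsLieRep {
  rep_bilinear : bilinear_map rho;
  rep_br : forall x y m,
    rho (lie_br x y) m = rho x (rho y m) - rho y (rho x m)
}.

Definition linmap_comp (f h : linmap M M) : linmap M M.
Proof.
apply: (@mk_linmap _ _ _ (f \o h)) => a u v /=.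
by rewrite linmap_linear linmap_linear.
Defined.

Definition linmap_id : linmap M M.
Proof. by apply: (@mk_linmap _ _ _ id). Defined.

Fact linmap_is_algebra : is_algebra linmap_comp linmap_id.
Proof.
split=> [|f1 f2 f3|f|f]; try exact: linmap_ext.
split=> h a f1 f2; apply: linmap_ext => m //.
exact: linmap_linear.
Qed.

(** A representation of g extends to an algebra morphism uea g -> End(M), which
    is then evaluated at a vector m0. The maps Phi and Psi and the operators D_x
    are all obtained in this way. *)
Lemma uea_orbit_map (rho : g -> M -> M) (m0 : M) : is_lie_rep rho ->
  exists Phi : uea g -> M, [/\ linear Phi, Phi 1 = m0
    & forall x u, Phi (uea_gen x * u) = rho x (Phi u)].
Proof.
move=> [rho_bil rho_br].
pose f x := mk_linmap (rho_bil.2 x).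
have f_lin : linear f.
  by move=> a x y; apply: linmap_ext => m; apply: (rho_bil.1 m).
have f_br x y :
    f (lie_br x y) = linmap_comp (f x) (f y) - linmap_comp (f y) (f x).
  by apply: linmap_ext => m; apply: rho_br.
have alg := linmap_is_algebra.
exists (fun u => uea_lift linmap_comp linmap_id f u m0); split=> [a u v||x u].
- by rewrite (uea_lift_linear alg f_lin f_br).
- by rewrite [uea_lift _ _ _ _](uea_lift_one alg f_lin f_br).
- rewrite [uea_lift _ _ _ _](uea_lift_mul alg f_lin f_br).
  by rewrite (uea_lift_gen alg f_lin f_br).
Qed.

End Representations.

Section LeftInduction.
Variables (k : fieldType) (g : lie_algebra k).

(** The enveloping algebra is spanned by words in the generators; the formulas
    below describe how operators act on x u, for a generator x. *)
Lemma uea_left_ind (Q : uea g -> Prop) :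
  Q 1 -> (forall x u, Q u -> Q (uea_gen x * u)) ->
  (forall u v, Q u -> Q v -> Q (u + v)) -> (forall c u, Q u -> Q (c *: u)) ->
  forall u, Q u.
Proof.
move=> Q1 Qg QD QZ u.
suff H : forall v, Q v -> Q (u * v) by rewrite -[u]mulr1; apply: H.
elim/uea_ind: u => [x v|v|u u' IH IH' v Qv|u u' IH IH' v Qv|c u IH v Qv].
- exact: Qg.
- by rewrite mul1r.
- by rewrite mulrDl; apply: QD; [apply: IH|apply: IH'].
- by rewrite -mulrA; apply/IH/IH'.
- by rewrite -scalerAl; apply/QZ/IH.
Qed.

End LeftInduction.

(** * Calculus of tensors *)

Section TensorMaps.
Variable k : fieldType.
Implicit Types A B C M U V W : lmodType k.

Lemma linear_comp U V W (f : V -> W) (h : U -> V) :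
  linear f -> linear h -> linear (f \o h).
Proof. by move=> lf lh a u v /=; rewrite lh lf. Qed.

Lemma lin_tlift U V M M' (G : M -> M') (f : U -> V -> M) t :
  linear G -> G (tlift f t) = tlift (fun u v => G (f u v)) t.
Proof.
move=> lG; rewrite /tlift; elim: (repr t) => [|p s IH].
  by rewrite !big_nil (lin0 lG).
by rewrite !big_cons (linD lG) IH.
Qed.

Lemma eq_tlift U V M (f f' : U -> V -> M) t :
  (forall u v, f u v = f' u v) -> tlift f t = tlift f' t.
Proof. by move=> ff; apply: eq_bigr => p _. Qed.

Lemma tliftD U V M (f f' : U -> V -> M) t :
  tlift (fun u v => f u v + f' u v) t = tlift f t + tlift f' t.
Proof. exact: big_split. Qed.

Lemma tliftB U V M (f f' : U -> V -> M) t :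
  tlift (fun u v => f u v - f' u v) t = tlift f t - tlift f' t.
Proof. by rewrite /tlift sumrB. Qed.

Lemma bilinear_comp U V U' V' M (f : U -> V -> M) (g : U' -> U) (h : V' -> V) :
  bilinear_map f -> linear g -> linear h ->
  bilinear_map (fun u v => f (g u) (h v)).
Proof.
by move=> bf lg lh; split=> [v a u u'|u a v v']; rewrite ?lg ?lh (bf.1, bf.2).
Qed.

Lemma tlift_tmap U V U' V' M (f : U -> V -> M) (g : U' -> U) (h : V' -> V) t :
  bilinear_map f -> linear g -> linear h ->
  tlift f (tmap g h t) = tlift (fun u v => f (g u) (h v)) t.
Proof.
move=> bf lg lh; have bf' := bilinear_comp bf lg lh.
apply: (linear_tens_ext (f := tlift f \o tmap g h)) t => [||u v].
- exact: linear_comp (tlift_linear bf) (tmap_linear lg lh).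
- exact: tlift_linear.
- by rewrite /= tmap_tensor // !tlift_tensor.
Qed.

Lemma tmap_comp U V U' V' U2 V2 (g : U' -> U) (h : V' -> V)
    (g' : U2 -> U') (h' : V2 -> V') t :
  linear g -> linear h -> linear g' -> linear h' ->
  tmap g h (tmap g' h' t) = tmap (g \o g') (h \o h') t.
Proof.
move=> lg lh lg' lh'.
by rewrite /tmap tlift_tmap //; apply: tmap_bilinear.
Qed.

Lemma tassoc_tmap U V W U' V' W' (f : U -> U') (g : V -> V') (h : W -> W') t :
  linear f -> linear g -> linear h ->
  tassoc (tmap (tmap f g) h t) = tmap f (tmap g h) (tassoc t).
Proof.
move=> lf lg lh; have lfg := tmap_linear lf lg; have lgh := tmap_linear lg lh.
have la := @tassoc_linear k.
have tb V1 V2 := tensor_bilinear (k := k) V1 V2.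
elim/tens_ind: t => [|uv w|s t IHs IHt].
- rewrite (lin0 (tmap_linear lfg lh)) !(lin0 (la _ _ _)).
  by rewrite (lin0 (tmap_linear lf lgh)).
- rewrite tmap_tensor //; elim/tens_ind: uv => [|u v|s t IHs IHt].
  + rewrite (lin0 lfg) !(bil0l (tb _ _)) !(lin0 (la _ _ _)).
    by rewrite (lin0 (tmap_linear lf lgh)).
  + by rewrite tmap_tensor // !tassoc_tensor !tmap_tensor.
  + rewrite (linD lfg) !(bilDl (tb _ _)) !(linD (la _ _ _)) IHs IHt.
    by rewrite (linD (tmap_linear lf lgh)).
- rewrite (linD (tmap_linear lfg lh)) !(linD (la _ _ _)) IHs IHt.
  by rewrite (linD (tmap_linear lf lgh)).
Qed.

End TensorMaps.

(** * Transport of a Hopf algebra structure *)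

Section Transport.
Variables (k : fieldType) (K : hopf_algebra k) (W : lmodType k).
Variables (mul : W -> W -> W) (one : W) (Delta : W -> tens W W) (eps : W -> k).
Variables (Phi : K -> W) (Psi : W -> K).
Hypotheses (Phi_lin : linear Phi).
Hypotheses (PhiK : cancel Phi Psi) (PsiK : cancel Psi Phi).
Hypothesis Phi_mul : forall a b, Phi (hopf_mul a b) = mul (Phi a) (Phi b).
Hypothesis Phi_one : Phi (hopf_one K) = one.
Hypothesis Phi_comul : forall a, Delta (Phi a) = tmap Phi Phi (hopf_comul a).
Hypothesis Phi_counit : forall a, eps (Phi a) = hopf_counit a.

Let KH := hopfP K.
Let Kb : bilinear_map (@hopf_mul k K) := alg_bilinear (hopf_algebraP KH).

Let Psi_lin : linear Psi.
Proof. by move=> a u v; apply: (can_inj PhiK); rewrite Phi_lin !PsiK. Qed.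

Let mulE u v : mul u v = Phi (hopf_mul (Psi u) (Psi v)).
Proof. by rewrite Phi_mul !PsiK. Qed.

Let S u := Phi (hopf_antipode (Psi u)).

Let S_lin : linear S.
Proof.
by move=> a u v; rewrite /S Psi_lin (hopf_antipode_linear KH) Phi_lin.
Qed.

Let mul_bil : bilinear_map mul.
Proof.
by split=> [v a u u'|u a v v']; rewrite !mulE Psi_lin (Kb.1, Kb.2) Phi_lin.
Qed.

Let Delta_lin : linear Delta.
Proof.
move=> a u v; rewrite -[u]PsiK -[v]PsiK -Phi_lin !Phi_comul.
by rewrite (hopf_comul_linear KH) (tmap_linear Phi_lin Phi_lin).
Qed.

Let eps_lin : scalar eps.
Proof.
move=> a u v; rewrite -[u]PsiK -[v]PsiK -Phi_lin !Phi_counit.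
by rewrite (hopf_counit_linear KH).
Qed.

Let epsZ_bil : bilinear_map (fun u v : W => eps u *: v).
Proof.
split=> [v a u u'|u a v v']; first by rewrite eps_lin scalerDl scalerA.
by rewrite scalerDr !scalerA mulrC.
Qed.

(** As Phi is bijective, its compatibility with the operations of W determines
    them, and every axiom follows from the same axiom in K. *)
Lemma hopf_transport_axioms : is_hopf_algebra mul one Delta eps S.
Proof.
have [Kalg D_lin e_lin s_lin coass cul cur D1 DM e1 eM al ar] := KH.
have alg : is_algebra mul one.
  split=> [|u v w|u|u]; first exact: mul_bil.
  - by rewrite !mulE !PhiK (alg_mulA Kalg).
  - by rewrite mulE -Phi_one PhiK (alg_mul1l Kalg) PsiK.
  - by rewrite mulE -Phi_one PhiK (alg_mul1r Kalg) PsiK.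
have id_lin (A : lmodType k) : linear (@id A) by [].
split=> //.
- move=> a; rewrite -[a]PsiK Phi_comul !tmap_comp //.
  have -> : Delta \o Phi = tmap Phi Phi \o @hopf_comul k K.
    by apply: boolp.funext => v; rewrite /= Phi_comul.
  have e A B (f : A -> B) : f = f \o id by [].
  rewrite [X in tassoc (tmap _ X _)]e [X in _ = tmap X _ _]e.
  have lPP := tmap_linear Phi_lin Phi_lin.
  rewrite -[in LHS]tmap_comp // -[in RHS]tmap_comp //.
  by rewrite tassoc_tmap // coass.
- move=> a; rewrite -[a]PsiK Phi_comul tlift_tmap // -[in RHS](cul (Psi a)).
  rewrite lin_tlift //; apply: eq_tlift => u v.
  by rewrite Phi_counit (linZ Phi_lin).
- move=> a; rewrite -[a]PsiK Phi_comul tlift_tmap //; last by case: epsZ_bil.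
  rewrite -[in RHS](cur (Psi a)) lin_tlift //; apply: eq_tlift => u v.
  by rewrite Phi_counit (linZ Phi_lin).
- by rewrite -Phi_one Phi_comul D1 tmap_tensor.
- move=> a b; rewrite mulE Phi_comul DM -{2}[a]PsiK -{2}[b]PsiK !Phi_comul.
  have lPP := tmap_linear Phi_lin Phi_lin.
  have bKK := alg_bilinear (tens_mul_is_algebra alg alg).
  have PP s t : tmap Phi Phi (tens_mul (@hopf_mul k K) (@hopf_mul k K) s t)
      = tens_mul mul mul (tmap Phi Phi s) (tmap Phi Phi t).
    apply: (tens_multiplicative Kalg Kalg bKK lPP) => c d c' d'.
    rewrite (tens_mul_tensor Kalg Kalg) !tmap_tensor //.
    by rewrite (tens_mul_tensor alg alg) !Phi_mul.
  exact: PP.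
- by rewrite -Phi_one Phi_counit.
- by move=> a b; rewrite mulE Phi_counit eM -!Phi_counit !PsiK.
- move=> a; rewrite -[a]PsiK Phi_comul tlift_tmap //; last first.
    exact: (bilinear_comp mul_bil S_lin (id_lin W)).
  rewrite Phi_counit -Phi_one -(linZ Phi_lin) -al lin_tlift //.
  by apply: eq_tlift => u v; rewrite /S PhiK Phi_mul.
- move=> a; rewrite -[a]PsiK Phi_comul tlift_tmap //; last first.
    exact: (bilinear_comp mul_bil (id_lin W) S_lin).
  rewrite Phi_counit -Phi_one -(linZ Phi_lin) -ar lin_tlift //.
  by apply: eq_tlift => u v; rewrite /S PhiK Phi_mul.
Qed.

Lemma hopf_transport :
  exists (T : W -> W) (H : is_hopf_algebra mul one Delta eps T),
    hopf_isomorphic (HopfAlgebra H) K.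
Proof.
exists S, hopf_transport_axioms, Psi; last by exists Phi.
split=> //= [a b||a|a|a].
- by rewrite mulE PhiK.
- by rewrite -Phi_one PhiK.
- rewrite -{2}[a]PsiK Phi_comul tmap_comp //.
  have -> : Psi \o Phi = id by apply: boolp.funext => v; rewrite /= PhiK.
  by rewrite /tmap [LHS]tens_sumE.
- by rewrite -Phi_counit PsiK.
- by rewrite /S PhiK.
Qed.

End Transport.

(** * Coproducts of words *)

Section Leibniz.
Variables (k : fieldType) (V : lmodType k).
Implicit Types (M : lmodType k) (h : V -> V).

(** The operator h (x) id + id (x) h. Both multiplication by a primitive element
    and a coderivation are intertwined by the coproduct with an operator of this
    form, so that sums over Sweedler components can be compared termwise. *)
Definition tleibniz h (t : tens V V) : tens V V :=
  tlift (fun a b => tensor (h a) b + tensor a (h b)) t.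

Lemma tleibniz_bilinear M (f : V -> V -> M) h : bilinear_map f -> linear h ->
  bilinear_map (fun a b => f (h a) b + f a (h b)).
Proof.
move=> bf lh; split=> [v a u u'|u a v v'].
  by rewrite lh !(bf.1 _ a) scalerDr addrACA.
by rewrite lh !(bf.2 _ a) scalerDr addrACA.
Qed.

Lemma tleibniz_linear h : linear h -> linear (tleibniz h).
Proof.
move=> lh; apply: tlift_linear.
exact: tleibniz_bilinear (tensor_bilinear V V) lh.
Qed.

Lemma tleibniz_tensor h a b : linear h ->
  tleibniz h (tensor a b) = tensor (h a) b + tensor a (h b).
Proof.
move=> lh; rewrite /tleibniz tlift_tensor //.
by apply: tleibniz_bilinear => //; apply: tensor_bilinear.
Qed.

Lemma tlift_tleibniz M (f : V -> V -> M) h t : bilinear_map f -> linear h ->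
  tlift f (tleibniz h t) = tlift (fun a b => f (h a) b + f a (h b)) t.
Proof.
move=> bf lh; rewrite /tleibniz lin_tlift; last exact: tlift_linear.
by apply: eq_tlift => a b; rewrite (linD (tlift_linear bf)) !tlift_tensor.
Qed.

End Leibniz.

Section Words.
Variables (k : fieldType) (g : lie_algebra k).
Local Notation U := (uea g).
Local Notation gen := (@uea_gen k g).
Let Ub := alg_bilinear (@uea_is_algebra k g).

Lemma mul_gen_linear x : linear ( *%R (gen x) : U -> U).
Proof. exact: Ub.2. Qed.

Lemma coprod_gen_mul x u :
  uea_coprod (gen x * u) = tleibniz ( *%R (gen x)) (uea_coprod u).
Proof.
rewrite coprodM coprod_gen.
have aU := @uea_is_algebra k g.
have bUU := alg_bilinear (tens_mul_is_algebra aU aU).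
have lx := tleibniz_linear (mul_gen_linear x).
elim/tens_ind: (uea_coprod u) => [|a b|s t IHs IHt].
- by rewrite (bil0r bUU) (lin0 lx).
- rewrite (bilDl bUU) !(tens_mul_tensor aU aU) !mul1r tleibniz_tensor //.
  exact: mul_gen_linear.
- by rewrite (bilDr bUU) (linD lx) IHs IHt.
Qed.

Lemma counit_add (u v : U) : uea_counit (u + v) = uea_counit u + uea_counit v.
Proof. by have := counit_linear 1 u v; rewrite scale1r mul1r. Qed.

Lemma counit_scale c (u : U) : uea_counit (c *: u) = c * uea_counit u.
Proof. by have /= -> := scalable_linear (@counit_linear k g) c u. Qed.

Definition word (s : seq g) : U := foldr (fun x u => gen x * u) 1 s.

(** The ways of cutting a word into two complementary subwords, with
    multiplicity: they index the terms of the coproduct of the word. *)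
Fixpoint splits (s : seq g) : seq (seq g * seq g) :=
  if s is x :: s' then
    [seq (x :: p.1, p.2) | p <- splits s']
    ++ [seq (p.1, x :: p.2) | p <- splits s']
  else [:: ([::], [::])].

Lemma coprod_word s :
  uea_coprod (word s) = \sum_(p <- splits s) tensor (word p.1) (word p.2).
Proof.
elim: s => [|x s IH]; first by rewrite /= big_seq1 coprod1.
rewrite /= coprod_gen_mul IH big_cat !big_map /=.
have lx := tleibniz_linear (mul_gen_linear x).
elim: (splits s) => [|p r IHr]; first by rewrite !big_nil (lin0 lx) addr0.
rewrite !big_cons (linD lx) IHr tleibniz_tensor.
  by rewrite addrACA.
exact: mul_gen_linear.
Qed.

Lemma size_splits s p : p \in splits s -> (size p.1 + size p.2 = size s)%N.
Proof.
elim: s p => [|x s IH] p /=; first by rewrite inE => /eqP ->.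
rewrite mem_cat => /orP[] /mapP[q /IH <- ->] //=.
by rewrite addnS.
Qed.

(** Only one splitting has an empty right part, the trivial one. *)
Lemma sum_splitsl (h : seq g -> U) s :
  \sum_(p <- splits s) (if nilp p.2 then h p.1 else 0) = h s.
Proof.
elim: s h => [|x s IH] h; first by rewrite /= big_seq1.
rewrite /= big_cat !big_map /= (IH (fun s => h (x :: s))).
by rewrite [X in _ + X]big1 // addr0.
Qed.

Lemma sum_splitsr (h : seq g -> U) s :
  \sum_(p <- splits s) (if nilp p.1 then h p.2 else 0) = h s.
Proof.
elim: s h => [|x s IH] h; first by rewrite /= big_seq1.
rewrite /= big_cat !big_map /= (IH (fun s => h (x :: s))).
by rewrite [X in X + _]big1 // add0r.
Qed.

Lemma uea_word_ext (M : lmodType k) (f h : U -> M) : linear f -> linear h ->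
  (forall s, f (word s) = h (word s)) -> f =1 h.
Proof.
move=> lf lh fh u; elim/uea_left_ind: u f h lf lh fh =>
  [|x u IH|u v IHu IHv|c u IH] f h lf lh fh.
- exact: (fh [::]).
- have lx := mul_gen_linear x.
  apply: (IH (f \o *%R (gen x)) (h \o *%R (gen x))) => [||s];
    try exact: linear_comp.
  exact: (fh (x :: s)).
- by rewrite (linD lf) (linD lh) (IHu f h) // (IHv f h).
- by rewrite (linZ lf) (linZ lh) (IH f h).
Qed.

(** On a nonempty word w, the terms w (x) 1 and 1 (x) w of the coproduct
    contribute f w each, and by induction on the length the other terms
    contribute 0; so f w = f w + f w. *)
Lemma convolution_idempotent (f : U -> U) : linear f -> f 1 = 1 ->
  (forall u, f u = tlift (fun a b => f a * f b) (uea_coprod u)) ->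
  forall u, f u = uea_counit u *: 1.
Proof.
move=> lf f1 ff; have le := @counit_linear k g.
have bff : bilinear_map (fun a b => f a * f b) by apply: bilinear_comp.
apply: uea_word_ext => [|a u v|s]; first exact: lf.
  by rewrite le scalerDl scalerA.
have [n le_sn] := ubnP (size s); elim: n s le_sn => // n IH [_|x s lt_sn].
  by rewrite /= f1 counit1 scale1r.
rewrite /= counitM counit_gen mul0r scale0r.
have IHs q : (size q <= size s)%N -> f (word q) = if nilp q then 1 else 0.
  move=> le_qs; rewrite IH; last exact: leq_ltn_trans le_qs lt_sn.
  case: q {le_qs} => [|y q] /=; first by rewrite counit1 scale1r.
  by rewrite counitM counit_gen mul0r scale0r.
have lff := tlift_linear bff.
have f_word s' :
    f (word s') = \sum_(p <- splits s') f (word p.1) * f (word p.2).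
  rewrite ff coprod_word; elim: (splits s') => [|p r IHr].
    by rewrite !big_nil (lin0 lff).
  by rewrite !big_cons (linD lff) IHr tlift_tensor.
apply: (@addrI _ (f (word (x :: s)))); rewrite addr0 [RHS]f_word /=.
(* The two copies of f (word (x :: s)) are matched with the splittings that put
   x on the left and with those that put x on the right. *)
rewrite big_cat !big_map /=.
rewrite -[X in X + _](sum_splitsl (fun s => f (word (x :: s)))).
rewrite -(sum_splitsr (fun s => f (word (x :: s)))).
congr (_ + _); rewrite !big_seq; apply: eq_bigr => p /size_splits size_p.
  rewrite [f (word p.2)]IHs -?size_p ?leq_addl //.
  by case: ifP; rewrite ?mulr1 ?mulr0.
rewrite [f (word p.1)]IHs -?size_p ?leq_addr //.
by case: ifP; rewrite ?mul1r ?mul0r.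
Qed.

End Words.

(** * Identities in a post-Lie algebra *)

Section PostLieIdentities.
Variables (k : fieldType) (P : post_lie_algebra k).
Implicit Types x y z : P.

(** The product of the dual post-Lie algebra, whose bracket is the opposite of
    that of P and whose sub-adjacent Lie algebra is the same. It measures how
    x |> _ fails to be a derivation for the sub-adjacent bracket
    (pl_tri_sub_adjacentr), and it is the twist of the operators D_x on V. *)
Definition dual_act (y x : P) : P := pl_tri y x + lie_br y x.

Let b := lie_bilinear (lieP P).
Let t := pl_tri_bilinear P.
Let bilE := (bilDl b, bilDr b, bilDl t, bilDr t,
  bilNl b, bilNr b, bilNl t, bilNr t).

Lemma dual_act_bilinear : bilinear_map dual_act.
Proof.
by split=> [v a u u'|u a v v']; rewrite /dual_act ?bilE
  ?(bilZl b, bilZr b, bilZl t, bilZr t) scalerDr addrACA.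
Qed.

Lemma pl_tri_sub_adjacent x y z :
  pl_tri (sub_adjacent_br x y) z
  = pl_tri x (pl_tri y z) - pl_tri y (pl_tri x z).
Proof.
rewrite /sub_adjacent_br !bilE !pl_br_tri /associator.
by zmod_eq.
Qed.

Lemma pl_tri_sub_adjacentr x y z :
  pl_tri x (sub_adjacent_br y z)
  = sub_adjacent_br (pl_tri x y) z + sub_adjacent_br y (pl_tri x z)
    - pl_tri (dual_act y x) z + pl_tri (dual_act z x) y.
Proof.
rewrite /sub_adjacent_br /dual_act !bilE !pl_br_tri !pl_tri_br /associator.
by zmod_eq.
Qed.

Lemma dual_act_sub_adjacent x y z :
  dual_act (sub_adjacent_br x y) z
  = dual_act x (dual_act y z) - dual_act y (dual_act x z).
Proof.
rewrite /sub_adjacent_br /dual_act !bilE !pl_br_tri !pl_tri_br /associator.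
rewrite (lie_jacobi_der x y z).
by zmod_eq.
Qed.

Lemma dual_act_sub_adjacentr x y z :
  dual_act z (sub_adjacent_br x y)
  = sub_adjacent_br (dual_act z x) y + sub_adjacent_br x (dual_act z y)
    + dual_act (pl_tri y z) x - dual_act (pl_tri x z) y.
Proof.
rewrite /sub_adjacent_br /dual_act !bilE !pl_br_tri !pl_tri_br /associator.
rewrite (lie_jacobi_der z x y) (lie_brC x (pl_tri z y)).
rewrite (lie_brC x (lie_br z y)) (lie_brC (lie_br z x) y).
by zmod_eq.
Qed.

Lemma dual_actE y x : dual_act y x = sub_adjacent_br y x + pl_tri x y.
Proof.
by rewrite /dual_act /sub_adjacent_br; zmod_eq.
Qed.

End PostLieIdentities.

(** * The post-Lie action on the sub-adjacent enveloping algebra *)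

Section Derivations.
Variables (k : fieldType) (P : post_lie_algebra k).
Local Notation V := (uea (sub_adjacent P)).
Local Notation vgen := (@uea_gen k (sub_adjacent P)).

Lemma vgenD (x y : P) : vgen (x + y) = vgen x + vgen y.
Proof. exact: (linD (@uea_gen_linear k (sub_adjacent P))). Qed.

Lemma vgenN (x : P) : vgen (- x) = - vgen x.
Proof. exact: (linN (@uea_gen_linear k (sub_adjacent P))). Qed.

Lemma vgen_br (x y : P) :
  vgen (sub_adjacent_br x y) = vgen x * vgen y - vgen y * vgen x.
Proof. exact: (uea_gen_br (g := sub_adjacent P)). Qed.

(** D x is the operator x |> _ read in V, where the product of U is expressed as
    y A = y * A - y |> A. The rule twd_mul is what the derivation rule of
    x |> _ becomes: the correction
      x |> (y |> A) - y |> (x |> A) - (x |> y) |> A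
    is ([x, y] - y |> x) |> A. *)
Record is_twisted_derivation (D : P -> V -> V) : Prop := IsTwistedDerivation {
  twd_bilinear : bilinear_map D;
  twd1 : forall x, D x 1 = 0;
  twd_mul : forall x y A,
    D x (vgen y * A)
    = vgen (pl_tri x y) * A + vgen y * D x A - D (dual_act y x) A
}.

(** The rule twd_mul determines the family D _ A recursively, but it must be
    seen to respect the relations of V. So V acts on pairs (A, d), with d
    standing for the family D _ A, and the relations hold because this is a
    representation of the sub-adjacent Lie algebra; the orbit of (1, 0) is
    A |-> (A, D _ A). *)
Lemma twisted_derivation_exists : exists D, is_twisted_derivation D.
Proof.
have tb := pl_tri_bilinear P; have db := dual_act_bilinear P.
have gl := @uea_gen_linear k (sub_adjacent P).
pose r y (m : V * linmap P V) x :=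
  vgen (pl_tri x y) * m.1 + vgen y * m.2 x - m.2 (dual_act y x).
have r_lin y m : linear (r y m).
  move=> a x x'; rewrite /r (bilDl tb) (bilZl tb) (bilDr db) (bilZr db) gl.
  rewrite !(linmap_linear m.2) !mulrDl !mulrDr -!scalerAl -!scalerAr.
  by rewrite !scalerDr scalerN; zmod_eq.
pose rho y m : V * linmap P V := (vgen y * m.1, mk_linmap (r_lin y m)).
have rho_rep : is_lie_rep (g := sub_adjacent P) rho.
  split=> [|y z m].
    split=> [m a y y'|y a m m']; apply: pair_ext.
    - by rewrite /= gl mulrDl scalerAl.
    - apply: linmap_ext => x.
      change (r (a *: y + y') m x = a *: r y m x + r y' m x); rewrite /r.
      rewrite (bilDr tb) (bilZr tb) (bilDl db) (bilZl db) !gl.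
      rewrite (linmap_linear m.2).
      rewrite !mulrDl -!scalerAl !scalerDr scalerN.
      by zmod_eq.
    - by rewrite /= mulrDr -scalerAr.
    - apply: linmap_ext => x.
      change (r y (a *: m + m') x = a *: r y m x + r y m' x); rewrite /r.
      change (vgen (pl_tri x y) * (a *: m.1 + m'.1)
        + vgen y * (a *: m.2 x + m'.2 x)
        - (a *: m.2 (dual_act y x) + m'.2 (dual_act y x)) =
        a *: (vgen (pl_tri x y) * m.1 + vgen y * m.2 x - m.2 (dual_act y x)) +
        (vgen (pl_tri x y) * m'.1 + vgen y * m'.2 x - m'.2 (dual_act y x))).
      rewrite !mulrDr -!scalerAr !scalerDr scalerN.
      by zmod_eq.
  apply: pair_ext; first by rewrite /= vgen_br mulrBl !mulrA.
  apply: linmap_ext => x.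
  change (r (sub_adjacent_br y z) m x = r y (rho z m) x - r z (rho y m) x).
  rewrite {2 3}/r /= /r.
  rewrite pl_tri_sub_adjacentr dual_act_sub_adjacent 3!vgenD vgenN !vgen_br.
  rewrite (linD (linmap_linear m.2)) (linN (linmap_linear m.2)).
  rewrite !(mulrDl, mulrDr, mulrBl, mulrBr, mulNr, mulrN) !mulrA.
  by zmod_eq.
have [Phi [Phi_lin Phi1 Phi_mul]] := uea_orbit_map (1, 0) rho_rep.
have Phi_fst A : (Phi A).1 = A.
  elim/uea_left_ind: A => [|x A IH|A B IHA IHB|c A IH].
  - by rewrite Phi1.
  - by rewrite Phi_mul /= IH.
  - by rewrite (linD Phi_lin) /= IHA IHB.
  - by rewrite (linZ Phi_lin) /= IH.
exists (fun x A => (Phi A).2 x); split=> [|x|x y A].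
- split=> [A|x a A B]; first exact: linmap_linear.
  by rewrite Phi_lin.
- by rewrite Phi1.
- by rewrite Phi_mul /= /r Phi_fst.
Qed.

End Derivations.

(** * The isomorphism of vector spaces *)

Section Inverse.
Variables (k : fieldType) (P : post_lie_algebra k).
Local Notation V := (uea (sub_adjacent P)).
Local Notation U := (uea P).
Local Notation vgen := (@uea_gen k (sub_adjacent P)).
Local Notation gen := (@uea_gen k P).

Section TwistedDerivation.
Variable D : P -> V -> V.
Hypothesis D_twd : is_twisted_derivation D.

Let Db := twd_bilinear D_twd.

(** On products z A, the terms produced by the twist cancel by
    dual_act_sub_adjacentr. *)
Lemma twd_br x y A : D (sub_adjacent_br x y) A = D x (D y A) - D y (D x A).
Proof.
elim/uea_left_ind: A x y => [|z A IH|A B IHA IHB|c A IH] x y.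
- by rewrite !(twd1 D_twd) !(bil0r Db) subrr.
- rewrite !(twd_mul D_twd, bilDr Db, bilNr Db) dual_act_sub_adjacentr.
  rewrite 3!(bilDl Db) (bilNl Db) !IH pl_tri_sub_adjacent vgenD vgenN.
  rewrite !(mulrDl, mulrDr, mulrBl, mulrBr, mulNr, mulrN).
  by zmod_eq.
- by rewrite !(bilDr Db) IHA IHB opprD addrACA.
- by rewrite !(bilZr Db) IH scalerBr.
Qed.

(** Since x A = x * A - x |> A in U, the operator of x is multiplication by x in
    U, read in V: the bracket represented is that of P, not the sub-adjacent
    one. *)
Lemma twisted_mul_rep :
  is_lie_rep (g := P) (fun x A => vgen x * A - D x A).
Proof.
have gl := @uea_gen_linear k (sub_adjacent P).
split=> [|x y A].
  split=> [A a x x'|x a A A'].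
    rewrite (bilDl Db) (bilZl Db) gl mulrDl -scalerAl scalerBr.
    by zmod_eq.
  rewrite (bilDr Db) (bilZr Db) mulrDr -scalerAr scalerBr.
  by zmod_eq.
have -> : lie_br x y = sub_adjacent_br x y - pl_tri x y + pl_tri y x.
  by rewrite /sub_adjacent_br; zmod_eq.
rewrite vgenD vgenD vgenN vgen_br 2!(bilDl Db) (bilNl Db) twd_br.
rewrite !(bilDr Db, bilNr Db, twd_mul D_twd).
have D_dual z w :
    D (dual_act z w) A = D z (D w A) - D w (D z A) + D (pl_tri w z) A.
  by rewrite dual_actE (bilDl Db) twd_br.
rewrite !D_dual !(mulrDl, mulrDr, mulrBl, mulrBr, mulNr, mulrN) !mulrA.
by zmod_eq.
Qed.

End TwistedDerivation.

Variable tri : U -> U -> U.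
Hypothesis tri_ext : is_post_lie_extension tri.
Let tb := ext_bilinear tri_ext.

Lemma tri_gen_mul x B C :
  tri (gen x) (B * C) = tri (gen x) B * C + B * tri (gen x) C.
Proof.
rewrite (ext_mulr tri_ext) coprod_gen.
have l : bilinear_map (fun A1 A2 => tri A1 B * tri A2 C).
  split=> [v a u u'|u a v v']; rewrite (bilDl tb) (bilZl tb) ?mulrDl ?mulrDr.
    by rewrite -scalerAl.
  by rewrite -scalerAr.
by rewrite (linD (tlift_linear l)) !tlift_tensor // !(ext_one tri_ext).
Qed.

Lemma tri_gen1 x : tri (gen x) 1 = 0.
Proof.
apply: (@addrI _ (tri (gen x) 1)).
by rewrite addr0 -[in RHS](mulr1 1) tri_gen_mul mulr1 mul1r.
Qed.

(** Both sides are derivations of U in C that agree on generators. *)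
Lemma tri_gen_sub_adjacent x y C :
  tri (gen (sub_adjacent_br x y)) C
  = tri (gen x) (tri (gen y) C) - tri (gen y) (tri (gen x) C).
Proof.
elim/uea_left_ind: C => [|z C IH|A B IHA IHB|c A IH].
- by rewrite !tri_gen1 !(bil0r tb) subrr.
- rewrite !(tri_gen_mul, ext_gen tri_ext, bilDr tb) IH pl_tri_sub_adjacent.
  rewrite (linD (@uea_gen_linear k P)) (linN (@uea_gen_linear k P)).
  rewrite !(mulrDl, mulrDr, mulrBl, mulrBr, mulNr, mulrN).
  by zmod_eq.
- by rewrite !(bilDr tb) IHA IHB opprD addrACA.
- by rewrite !(bilZr tb) IH scalerBr.
Qed.

Lemma star_gen_rep :
  is_lie_rep (g := sub_adjacent P) (fun x A => gen x * A + tri (gen x) A).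
Proof.
have gl := @uea_gen_linear k P.
split=> [|x y A].
  split=> [A a x x'|x a A A'].
    rewrite gl (bilDl tb) (bilZl tb) mulrDl -scalerAl scalerDr.
    by rewrite addrACA.
  rewrite (bilDr tb) (bilZr tb) mulrDr -scalerAr scalerDr.
  by rewrite addrACA.
rewrite tri_gen_sub_adjacent /lie_br /=.
rewrite !(bilDr tb) !tri_gen_mul !(ext_gen tri_ext).
rewrite {1}/sub_adjacent_br !(linD gl) !(linN gl) uea_gen_br.
rewrite !(mulrDl, mulrDr, mulrBl, mulrBr, mulNr, mulrN) !mulrA.
by zmod_eq.
Qed.

(** The inverse is the orbit map of A |-> x A - D x A; once Phi and Psi are
    known to intertwine D x with x |> _, the term D x A cancels x |> Phi A. *)
Lemma star_gen_orbit_bijective (Phi : V -> U) :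
  linear Phi -> Phi 1 = 1 ->
  (forall x A, Phi (vgen x * A) = gen x * Phi A + tri (gen x) (Phi A)) ->
  exists Psi : U -> V, [/\ linear Psi, cancel Phi Psi & cancel Psi Phi].
Proof.
move=> Phi_lin Phi1 Phi_mul; have [D D_twd] := twisted_derivation_exists P.
have Db := twd_bilinear D_twd.
have [Psi [Psi_lin Psi1 Psi_mul]] := uea_orbit_map 1 (twisted_mul_rep D_twd).
have Phi_D x A : Phi (D x A) = tri (gen x) (Phi A).
  elim/uea_left_ind: A x => [|z A IH|A B IHA IHB|c A IH] x.
  - by rewrite (twd1 D_twd) (lin0 Phi_lin) Phi1 tri_gen1.
  - rewrite (twd_mul D_twd) !(linD Phi_lin) (linN Phi_lin) !Phi_mul !IH.
    rewrite (bilDr tb) tri_gen_mul (ext_gen tri_ext).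
    rewrite dual_actE (linD (@uea_gen_linear k P)) (bilDl tb).
    rewrite tri_gen_sub_adjacent.
    by zmod_eq.
  - by rewrite (bilDr Db) !(linD Phi_lin) IHA IHB (bilDr tb).
  - by rewrite (bilZr Db) !(linZ Phi_lin) IH (bilZr tb).
have Psi_tri x u : Psi (tri (gen x) u) = D x (Psi u).
  elim/uea_left_ind: u => [|z u IH|u v IHu IHv|c u IH].
  - by rewrite tri_gen1 (lin0 Psi_lin) Psi1 (twd1 D_twd).
  - rewrite tri_gen_mul (ext_gen tri_ext) (linD Psi_lin) !Psi_mul IH.
    rewrite (bilDr Db) (bilNr Db) (twd_mul D_twd).
    rewrite dual_actE (bilDl Db) (twd_br D_twd).
    by zmod_eq.
  - by rewrite (bilDr tb) !(linD Psi_lin) IHu IHv (bilDr Db).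
  - by rewrite (bilZr tb) !(linZ Psi_lin) IH (bilZr Db).
exists Psi; split=> //.
- elim/uea_left_ind=> [|x A IH|A B IHA IHB|c A IH].
  + by rewrite Phi1 Psi1.
  + by rewrite Phi_mul (linD Psi_lin) Psi_mul Psi_tri IH subrK.
  + by rewrite (linD Phi_lin) (linD Psi_lin) IHA IHB.
  + by rewrite (linZ Phi_lin) (linZ Psi_lin) IH.
- elim/uea_left_ind=> [|x u IH|u v IHu IHv|c u IH].
  + by rewrite Psi1 Phi1.
  + by rewrite Psi_mul (linD Phi_lin) (linN Phi_lin) Phi_mul Phi_D IH addrK.
  + by rewrite (linD Psi_lin) (linD Phi_lin) IHu IHv.
  + by rewrite (linZ Psi_lin) (linZ Phi_lin) IH.
Qed.

End Inverse.

(** * Compatibility with the product and the coproduct *)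

Section Star.
Variables (k : fieldType) (P : post_lie_algebra k).
Local Notation V := (uea (sub_adjacent P)).
Local Notation U := (uea P).
Local Notation vgen := (@uea_gen k (sub_adjacent P)).
Local Notation gen := (@uea_gen k P).
Variable tri : U -> U -> U.
Hypothesis tri_ext : is_post_lie_extension tri.
Let tb := ext_bilinear tri_ext.
Let Ub := alg_bilinear (@uea_is_algebra k P).
Let id_lin (A : lmodType k) : linear (@id A). Proof. by []. Qed.

Lemma tri_tri_mul_bilinear B C :
  bilinear_map (fun A1 A2 => tri A1 B * tri A2 C).
Proof. exact: bilinear_comp Ub (tb.1 B) (tb.1 C). Qed.

Lemma mul_tri_bilinear B : bilinear_map (fun A1 A2 => A1 * tri A2 B).
Proof. exact: bilinear_comp Ub (@id_lin U) (tb.1 B). Qed.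

Lemma tri1 A : tri A 1 = uea_counit A *: 1.
Proof.
apply: (convolution_idempotent (tb.1 1)) => [|u].
  exact: (ext_one tri_ext).
by rewrite -[in LHS](mulr1 1) (ext_mulr tri_ext).
Qed.

Lemma counit_tri_gen x u : uea_counit (tri (gen x) u) = 0.
Proof.
elim/uea_left_ind: u => [|z u IH|u v IHu IHv|c u IH].
- by rewrite (tri_gen1 tri_ext) -(scale0r 0) counit_scale mul0r.
- rewrite (tri_gen_mul tri_ext) (ext_gen tri_ext).
  rewrite counit_add !counitM !counit_gen.
  by rewrite !mul0r addr0.
- by rewrite (bilDr tb) counit_add IHu IHv addr0.
- by rewrite (bilZr tb) counit_scale IH mulr0.
Qed.

Lemma coprod_tri_gen x u :
  uea_coprod (tri (gen x) u) = tleibniz (tri (gen x)) (uea_coprod u).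
Proof.
have lt : linear (tri (gen x)) := tb.2 _; have llt := tleibniz_linear lt.
have Tb := tensor_bilinear (k := k) U U.
elim/uea_left_ind: u => [|z u IH|u v IHu IHv|c u IH].
- rewrite coprod1 (tri_gen1 tri_ext) (lin0 (@coprod_linear _ _)).
  rewrite tleibniz_tensor //.
  by rewrite (tri_gen1 tri_ext) (bil0l Tb) (bil0r Tb) addr0.
- rewrite (tri_gen_mul tri_ext) (ext_gen tri_ext) (linD (@coprod_linear _ _)).
  rewrite !coprod_gen_mul IH.
  have lz := mul_gen_linear z; have lxz := mul_gen_linear (pl_tri x z).
  elim/tens_ind: (uea_coprod u) => [|a b|s t IHs IHt].
  + by rewrite !(lin0 llt, lin0 (tleibniz_linear (mul_gen_linear _))) addr0.
  + rewrite !tleibniz_tensor // (linD llt) (linD (tleibniz_linear lz)).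
    rewrite !tleibniz_tensor //.
    rewrite !(tri_gen_mul tri_ext) !(ext_gen tri_ext) (bilDl Tb) (bilDr Tb).
    by zmod_eq.
  + rewrite !(linD llt, linD (tleibniz_linear (mul_gen_linear _))) addrACA.
    by rewrite IHs IHt.
- by rewrite (bilDr tb) !(linD (@coprod_linear _ _)) IHu IHv (linD llt).
- by rewrite (bilZr tb) !(linZ (@coprod_linear _ _)) IH (linZ llt).
Qed.

(** The defining rule for C in P extends to products C because x |> _ is at once
    a derivation for the product and a coderivation for the coproduct. *)
Lemma tri_gen_mull y u C :
  tri (gen y * u) C = tri (gen y) (tri u C) - tri (tri (gen y) u) C.
Proof.
have lt : linear (tri (gen y)) := tb.2 _.
elim/uea_left_ind: C u => [|z C IH|A B IHA IHB|c A IH] u.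
- rewrite !tri1 counitM counit_gen mul0r counit_tri_gen (linZ lt) tri1.
  by rewrite counit_gen !scale0r scaler0 subrr.
- have F := tri_tri_mul_bilinear (gen z) C.
  rewrite !(ext_mulr tri_ext) coprod_gen_mul coprod_tri_gen.
  rewrite !tlift_tleibniz //; last exact: mul_gen_linear.
  rewrite (lin_tlift _ _ lt) -tliftB; apply: eq_tlift => a b.
  rewrite (ext_mull tri_ext) IH (tri_gen_mul tri_ext) !(mulrBl, mulrBr).
  by zmod_eq.
- by rewrite !(bilDr tb) IHA IHB opprD addrACA.
- by rewrite !(bilZr tb) IH scalerBr.
Qed.

Lemma star_gen_mull y u C :
  star tri (gen y * u + tri (gen y) u) C
  = gen y * star tri u C + tri (gen y) (star tri u C).
Proof.
have F := mul_tri_bilinear C; have lt : linear (tri (gen y)) := tb.2 _.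
rewrite /star (linD (@coprod_linear _ _)) coprod_gen_mul coprod_tri_gen.
rewrite (linD (tlift_linear F)) !tlift_tleibniz //; last exact: mul_gen_linear.
rewrite (lin_tlift _ _ lt) (lin_tlift _ _ (mul_gen_linear y)) -!tliftD.
apply: eq_tlift => a b.
rewrite tri_gen_mull (tri_gen_mul tri_ext) !(mulrBl, mulrBr) !mulrA.
by zmod_eq.
Qed.

Section Orbit.
Variable Phi : V -> U.
Hypotheses (Phi_lin : linear Phi) (Phi1 : Phi 1 = 1).
Hypothesis Phi_mul :
  forall x A, Phi (vgen x * A) = gen x * Phi A + tri (gen x) (Phi A).

Lemma orbit_star A B : Phi (A * B) = star tri (Phi A) (Phi B).
Proof.
have ls : linear (fun u => star tri u (Phi B)).
  have lB := tlift_linear (mul_tri_bilinear (Phi B)).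
  exact: linear_comp lB (@coprod_linear _ _).
elim/uea_left_ind: A => [|x A IH|A A' IH IH'|c A IH].
- rewrite mul1r Phi1 /star coprod1 tlift_tensor; last exact: mul_tri_bilinear.
  by rewrite (ext_one tri_ext) mul1r.
- by rewrite -mulrA !Phi_mul IH star_gen_mull.
- by rewrite mulrDl !(linD Phi_lin) IH IH' -(linD ls).
- by rewrite -scalerAl !(linZ Phi_lin) IH -(linZ ls).
Qed.

Lemma orbit_coprod A : uea_coprod (Phi A) = tmap Phi Phi (uea_coprod A).
Proof.
have lPP := tmap_linear Phi_lin Phi_lin.
elim/uea_left_ind: A => [|x A IH|A A' IH IH'|c A IH].
- by rewrite Phi1 !coprod1 tmap_tensor ?Phi1.
- rewrite Phi_mul (linD (@coprod_linear _ _)) coprod_gen_mul coprod_tri_gen.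
  rewrite [in RHS]coprod_gen_mul IH.
  have lx := mul_gen_linear (g := P) x.
  have lt : linear (tri (gen x)) := tb.2 _.
  have lvx := mul_gen_linear (g := sub_adjacent P) x.
  elim/tens_ind: (uea_coprod A) => [|a b|s t IHs IHt].
  + rewrite (lin0 (tleibniz_linear lvx)) (lin0 lPP).
    by rewrite (lin0 (tleibniz_linear lx)) (lin0 (tleibniz_linear lt)) addr0.
  + rewrite tmap_tensor // !tleibniz_tensor // (linD lPP) !tmap_tensor //.
    rewrite !Phi_mul.
    rewrite (bilDl (tensor_bilinear _ _)) (bilDr (tensor_bilinear _ _)).
    by rewrite addrACA.
  + rewrite (linD (tleibniz_linear lvx)) !(linD lPP) -IHs -IHt.
    by rewrite (linD (tleibniz_linear lx)) (linD (tleibniz_linear lt)) addrACA.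
- by rewrite (linD Phi_lin) !(linD (@coprod_linear _ _)) IH IH' (linD lPP).
- by rewrite (linZ Phi_lin) !(linZ (@coprod_linear _ _)) IH (linZ lPP).
Qed.

Lemma orbit_counit A : uea_counit (Phi A) = uea_counit A.
Proof.
elim/uea_left_ind: A => [|x A IH|A A' IH IH'|c A IH].
- by rewrite Phi1 !counit1.
- rewrite Phi_mul counit_add counit_tri_gen.
  by rewrite !counitM !counit_gen !mul0r addr0.
- by rewrite (linD Phi_lin) !counit_add IH IH'.
- by rewrite (linZ Phi_lin) !counit_scale IH.
Qed.

End Orbit.

End Star.

Theorem theorem3p4 (k : fieldType) (char_k : [pchar k] =i pred0)
    (P : post_lie_algebra k) (tri : uea P -> uea P -> uea P)
    (tri_ext : is_post_lie_extension tri) :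
  exists (S : uea P -> uea P)
         (H : is_hopf_algebra (star tri) 1 (@uea_coprod k P) (@uea_counit k P) S),
    hopf_isomorphic (HopfAlgebra H) (uea_hopf (sub_adjacent P)).
Proof.
have [Phi [Phi_lin Phi1 Phi_mul]] := uea_orbit_map 1 (star_gen_rep tri_ext).
have [Psi [_ PhiK PsiK]] :=
  star_gen_orbit_bijective tri_ext Phi_lin Phi1 Phi_mul.
apply: (hopf_transport (K := uea_hopf (sub_adjacent P)) Phi_lin PhiK PsiK).
- exact: (orbit_star tri_ext Phi_lin Phi1 Phi_mul).
- exact: Phi1.
- exact: (orbit_coprod tri_ext Phi_lin Phi1 Phi_mul).
- exact: (orbit_counit tri_ext Phi_lin Phi1 Phi_mul).
Qed.
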